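(* Let $\mathbb{X}$ be a real vector space with Hamel basis $(\mathbf b_l)_{l\in I}$, endowed with the topology induced by the norm $\|\sum_{l\in I}x^{(l)}\mathbf b_l\|_{\mathbb X,Hamel}=\sum_{l\in I}|x^{(l)}|$. Let $\bm\theta_0\in\mathbb{X}$, let $k\in\mathbb N$ be fixed, let $\bm\alpha=(\alpha_l)_{l\in I}$ with $\alpha_l\in(0,1)$, and let $T_{Hamel,\bm\alpha,n,k}=\mathbf q_{Hamel,\bm\alpha}(Z^{(1)}_{\lfloor n/k\rfloor},\dots,Z^{(k)}_{\lfloor n/k\rfloor})$. (1) If $Z_n\stackrel{p}{\to}\bm\theta_0$ as $n\to\infty$, then $T_{Hamel,\bm\alpha,n,k}\stackrel{p}{\to}\bm\theta_0$ as $n\to\infty$. (2) If $a_n(Z_n-\bm\theta_0)\stackrel{d}{\to}Y$ as $n\to\infty$, for some sequence $(a_n)_{n\in\mathbb N}$ of non-negative numbers going to infinity and some $\mathbb X$-valued random variable $Y$, then $a_{\lfloor n/k\rfloor}(T_{Hamel,\bm\alpha,n,k}-\bm\theta_0)\stackrel{d}{\to}\mathbf q_{Hamel,\bm\alpha}(Y_1,\dots,Y_k)$ as $n\to\infty$, where $Y_1,\dots,Y_k$ are i.i.d. copies of $Y$.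
   Context: Univariate quantile: for $\alpha\in(0,1)$ and $\mathbf x\in\mathbb R^k$ with increasingly ordered components $\tilde x_1\le\dots\le\tilde x_k$, $q_\alpha(\mathbf x)=\frac12(\tilde x_{\lceil k\alpha\rceil}+\tilde x_{\lfloor k\alpha+1\rfloor})$. Component-wise quantile with respect to the Hamel basis: if $\mathbf x_i=\sum_{l\in I}x_i^{(l)}\mathbf b_l$ (finitely many non-zero coefficients), $i=1,\dots,k$, then $\mathbf q_{Hamel,\bm\alpha}(\mathbf x_1,\dots,\mathbf x_k)=\sum_{l\in I}q_{\alpha_l}(x_1^{(l)},\dots,x_k^{(l)})\,\mathbf b_l$. Estimators: the data are i.i.d. observations. For each $m$, $Z_m$ is an $\mathbb X$-valued estimator of the parameter $\bm\theta_0$, i.e. a random element obtained by applying a fixed map to $m$ observations. A sample of $n$ i.i.d. observations is divided into $k$ disjoint blocks of equal size $\lfloor n/k\rfloor$, and $Z^{(i)}_{\lfloor n/k\rfloor}$ denotes the estimator computed from the observations in block $i$, $i=1,\dots,k$. There is no contamination of the sample in this statement.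
   Formalization: Random elements (the estimators, Y and its copies) are taken to be Borel measurable with separable range, which is automatic for a countable basis; with bare Borel measurability and a very large basis the quantile T need not be measurable, so the claim would be ill-defined. *)

(* Defs.v *)
From HB Require Import structures.
From mathcomp Require Import all_boot all_order all_algebra.
From mathcomp Require Import finmap.
From mathcomp Require Import all_classical all_reals all_analysis.
Import numFieldNormedType.Exports.
Import Order.TTheory GRing.Theory Num.Theory.

Set Implicit Arguments.
Unset Strict Implicit.
Unset Printing Implicit Defensive.

Local Open Scope classical_set_scope.
Local Open Scope ring_scope.

(* x~_j for j = 1, ..., k: the order statistics are indexed from 1. *)
Definition order_stat (R : realType) (k : nat) (x : 'I_k -> R) (j : nat) : R :=
  nth 0 (sort <=%R (codom x)) j.-1.

(* For 0 < alpha < 1 and 0 < k both indices lie in {1, ..., k}. *)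
Definition quantile (R : realType) (k : nat) (alpha : R) (x : 'I_k -> R) : R :=
  (order_stat x `|Num.ceil (k%:R * alpha)|%N +
   order_stat x `|Num.floor (k%:R * alpha + 1)|%N) / 2.

Definition finsupp_fun (R : realType) (I : choiceType) (c : I -> R) : Prop :=
  finite_set [set l | c l != 0].

Record hamel_basis (R : realType) (X : lmodType R) (I : choiceType)
    (b : I -> X) : Prop := HamelBasis {
  hamel_free : forall c : I -> R, finsupp_fun c ->
    \sum_(l \in [set: I]) c l *: b l = 0 -> forall l, c l = 0 ;
  hamel_span : forall x : X, exists2 c : I -> R,
    finsupp_fun c & x = \sum_(l \in [set: I]) c l *: b l }.

(* The coordinate x^(l) of x on b l; lemma hamel_coordP shows that the chosen
   coefficients are the right ones when b is a Hamel basis. *)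
Definition hamel_coord (R : realType) (X : lmodType R) (I : choiceType)
    (b : I -> X) (x : X) : I -> R :=
  xget (fun=> 0) [set c : I -> R |
    finsupp_fun c /\ x = \sum_(l \in [set: I]) c l *: b l].

Lemma hamel_coordP (R : realType) (X : lmodType R) (I : choiceType)
    (b : I -> X) (x : X) : hamel_basis b ->
  finsupp_fun (hamel_coord b x) /\
  x = \sum_(l \in [set: I]) hamel_coord b x l *: b l.
Proof.
move=> hb; have [c fc xc] := hamel_span hb x.
by rewrite /hamel_coord; case: xgetP => [c' _ //|/(_ c)]; case; split.
Qed.

Definition hamel_norm (R : realType) (X : lmodType R) (I : choiceType)
    (b : I -> X) (x : X) : R :=
  \sum_(l \in [set: I]) `|hamel_coord b x l|.

Definition hamel_quantile (R : realType) (X : lmodType R) (I : choiceType)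
    (b : I -> X) (alpha : I -> R) (k : nat) (x : 'I_k -> X) : X :=
  \sum_(l \in [set: I])
    quantile (alpha l) (fun i => hamel_coord b (x i) l) *: b l.

Definition borel (R : realType) (X : normedModType R) :=
  g_sigma_algebraType (@open X).

(* Random elements of a possibly nonseparable normed space: Borel measurable
   maps with separable range (strong measurability).  The second clause is
   automatic when X is separable, i.e. when it has a countable Hamel basis.  In
   general it makes sums and quantiles of random elements measurable again,
   and it makes the joint law of independent random elements depend on their
   marginals only. *)
Definition random_element d (T : measurableType d) (R : realType)
    (X : normedModType R) (f : T -> X) : Prop :=
  measurable_fun [set: T] (f : T -> borel X) /\
  exists2 D : set X, countable D & range f `<=` closure D.

Definition same_law (R : realType) d1 (T1 : measurableType d1)
    (P1 : probability T1 R) d2 (T2 : measurableType d2)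
    (P2 : probability T2 R) d (E : measurableType d)
    (X1 : T1 -> E) (X2 : T2 -> E) : Prop :=
  forall A : set E, measurable A -> P1 (X1 @^-1` A) = P2 (X2 @^-1` A).

Definition mutually_independent (R : realType) d1 (T : measurableType d1)
    (P : probability T R) d (E : measurableType d) (J : choiceType)
    (X : J -> T -> E) : Prop :=
  forall (S : {fset J}) (A : J -> set E), (forall j, measurable (A j)) ->
    P (\bigcap_(j in [set` S]) X j @^-1` A j) =
    (\prod_(j <- S) P (X j @^-1` A j))%E.

Definition iid (R : realType) d1 (T : measurableType d1)
    (P : probability T R) d (E : measurableType d) (J : choiceType)
    (X : J -> T -> E) : Prop :=
  [/\ forall j, measurable_fun [set: T] (X j),
      mutually_independent P X &
      forall i j, same_law P P (X i) (X j)].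

Definition iid_copies (R : realType) d1 (T1 : measurableType d1)
    (P1 : probability T1 R) d (T : measurableType d) (P : probability T R)
    (X : normedModType R) (Y : T -> X) (k : nat) (Yc : 'I_k -> T1 -> X) : Prop :=
  [/\ forall i, random_element (Yc i),
      iid P1 (Yc : 'I_k -> T1 -> borel X) &
      forall i, same_law P1 P (Yc i : T1 -> borel X) (Y : T -> borel X)].

Definition cvg_in_probability (R : realType) d (T : measurableType d)
    (P : probability T R) (X : normedModType R) (V : nat -> T -> X) (theta : X)
    : Prop :=
  forall eps : R, 0 < eps ->
    P [set w | eps < `|V n w - theta|] @[n --> \oo] --> 0%E.

Definition cvg_in_distribution (R : realType) d (T : measurableType d)
    (P : probability T R) d' (T' : measurableType d') (P' : probability T' R)
    (X : normedModType R) (V : nat -> T -> X) (V' : T' -> X) : Prop :=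
  forall f : X -> R, continuous f -> (exists M, forall x, `|f x| <= M) ->
    ('E_P[f \o V n] @[n --> \oo] --> 'E_P'[f \o V'])%E.

(* The estimator computed from the first m observations. *)
Definition estimator (T E X : Type) (z : forall m : nat, m.-tuple E -> X)
    (xi : nat -> T -> E) (m : nat) (w : T) : X :=
  z m [tuple xi j w | j < m].

(* Block i of the sample xi 0, ..., xi n.-1 consists of the observations of
   index blk (i, j); the blocks are disjoint when blk is injective. *)
Definition block_estimator (T E X : Type) (z : forall m : nat, m.-tuple E -> X)
    (xi : nat -> T -> E) (n k : nat) (blk : 'I_k * 'I_(n %/ k) -> 'I_n)
    (i : 'I_k) (w : T) : X :=
  z (n %/ k)%N [tuple xi (blk (i, j)) w | j < (n %/ k)%N].

Definition hamel_estimator (R : realType) (X : lmodType R) (I : choiceType)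
    (b : I -> X) (alpha : I -> R) (T E : Type)
    (z : forall m : nat, m.-tuple E -> X) (xi : nat -> T -> E) (k : nat)
    (blk : forall n : nat, 'I_k * 'I_(n %/ k) -> 'I_n) (n : nat) (w : T) : X :=
  hamel_quantile b alpha (fun i => block_estimator z xi (blk n) i w).

(* Main.v *)
Require Import Defs.
From HB Require Import structures.
From mathcomp Require Import all_boot all_order all_algebra.
From mathcomp Require Import finmap.
From mathcomp Require Import all_classical all_reals all_analysis.
From mathcomp Require Import measurable_realfun.
From mathcomp Require Import ring lra.
Import numFieldNormedType.Exports.
Import Order.TTheory GRing.Theory Num.Theory.

Local Open Scope classical_set_scope.
Local Open Scope ring_scope.

(** Write q for the component-wise quantile, a map from samples of size k in X
    to X.  A univariate quantile is monotone and commutes with translations,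
    hence moves by at most the sum of the displacements of the k entries;
    summing this over the coordinates shows that q is Lipschitz for the norm of
    X [hamel_quantile_lipschitz].  Moreover q commutes with the maps
    x |-> a (x - c) for a >= 0, and it fixes constant samples
    [hamel_quantile_affine, hamel_quantile_cst].  Finally the k block estimators
    are independent and all have the law of the estimator built from the first
    n / k observations [iid_blocks]; this last fact needs the pi-lambda theorem,
    applied to one block at a time [independent_copies_gen].

    For convergence in probability, the Lipschitz bound says that q of the block
    estimators is farther than eps from theta0 only if one of them is farther
    than eps / k, and a union bound concludes.

    For convergence in distribution, the rescaled error is q applied to the k
    rescaled block errors, so what is needed is the joint convergence of k
    independent copies of a sequence W n that converges in distribution to Y.
    As X may be nonseparable and no tightness is available, this is proved by
    hand for F(V n) with F bounded and Lipschitz on k-tuples.  The range of Y is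
    covered, up to a small probability, by finitely many small balls; a
    continuous partition of unity [cell] subordinate to these balls approximates
    F by a finite sum of products of functions of one coordinate
    [cell_sum_approx].  The expectation of a product factorizes by independence
    [expect_prod_independent], and each factor converges because W n does.
    The remainder is controlled by the expectation at W n of one continuous
    function that vanishes on the finitely many balls, and this converges too
    [independent_copies_cvg_lipschitz].  Bounded continuous test functions are
    then reached from bounded Lipschitz ones by Lipschitz envelopes
    [cvg_in_distribution_lipschitz]. *)

Set Implicit Arguments.
Unset Strict Implicit.
Unset Printing Implicit Defensive.

(** Expectations of bounded functions are taken in R, where sums, products and
    limits are easier to handle than in the extended reals; [expectationE]
    relates the two. *)
Local Notation expect P f := (Rintegral P [set: _] f).

(** * Order statistics and univariate quantiles *)

Section OrderStatistics.
Variables (R : realType) (k : nat).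
Implicit Types (x y : 'I_k -> R) (j : nat).

Lemma size_sort_codom x : size (sort <=%R (codom x)) = k.
Proof. by rewrite size_sort size_codom card_ord. Qed.

(** At any level u, lowering the sample can only increase the number of entries
    that are below u, and these counts determine the order statistics. *)
Lemma order_stat_monotone x y j : (forall i, x i <= y i) ->
  order_stat x j <= order_stat y j.
Proof.
move=> xy; rewrite /order_stat; move: j.-1 => i.
have [ik|ki] := ltnP i k; last by rewrite !nth_default ?size_sort_codom.
set u := nth 0 (sort _ (codom x)) i; rewrite leNgt; apply/negP => yu.
have : (i < count (< u) (sort <=%R (codom y)))%N.
  rewrite ltnNge; apply/negP => ci.
  have := @nth_count_ge _ R u 0 (sort <=%R (codom y)) i (sort_le_sorted _).
  by rewrite ci size_sort_codom ik leNgt yu => /(_ isT).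
rewrite (permP (permEl (perm_sort _ _))) codomE count_map => iy.
have : (i < count (< u) (sort <=%R (codom x)))%N.
  rewrite (permP (permEl (perm_sort _ _))) codomE count_map.
  by apply: (leq_trans iy); apply: sub_count => l /=; exact: le_lt_trans.
by move/(nth_count_lt 0 (sort_le_sorted _)); rewrite ltxx.
Qed.

(** A nondecreasing map keeps a sorted sequence sorted; h need not be injective,
    so this covers multiplication by 0.  The bound on j excludes the default
    value of [nth], which h would not preserve. *)
Lemma order_stat_comp (h : R -> R) x j : {homo h : u v / u <= v} ->
  (j.-1 < k)%N -> order_stat (h \o x) j = h (order_stat x j).
Proof.
move=> hh jk; rewrite /order_stat -(nth_map 0 0 h) ?size_sort_codom//.
congr nth; apply: le_sorted_eq.
- exact: sort_le_sorted.
- exact/(homo_sorted hh)/sort_le_sorted.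
- rewrite perm_sort (_ : codom _ = map h (codom x)); first last.
    by rewrite !codomE -map_comp.
  by rewrite perm_sym perm_map// perm_sort.
Qed.

End OrderStatistics.

Section Quantile.
Variables (R : realType) (k : nat) (alpha : R).
Hypotheses (k0 : (0 < k)%N) (alpha01 : 0 < alpha < 1).
Implicit Types x y : 'I_k -> R.

Lemma ceil_index_lt : (`|Num.ceil (k%:R * alpha)|%N.-1 < k)%N.
Proof.
have /andP[a0 a1] := alpha01.
have kR : 0 < k%:R :> R by rewrite ltr0n.
have : (`|Num.ceil (k%:R * alpha)|%N <= k)%N.
  have c0 : 0 <= Num.ceil (k%:R * alpha).
    by rewrite ceil_ge0 (lt_le_trans (ltrN10 _))// mulr_ge0// ltW.
  rewrite -lez_nat gez0_abs//.
  by rewrite ceil_le_int ler_piMr// ltW.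
by case: absz => [|n] //=.
Qed.

Lemma floor_index_lt : (`|Num.floor (k%:R * alpha + 1)|%N.-1 < k)%N.
Proof.
have /andP[a0 a1] := alpha01.
have kR : 0 < k%:R :> R by rewrite ltr0n.
have : (`|Num.floor (k%:R * alpha + 1)|%N <= k)%N.
  have c0 : 0 <= Num.floor (k%:R * alpha + 1).
    by rewrite floor_ge0 addr_ge0// mulr_ge0// ltW.
  rewrite -lez_nat gez0_abs// -ltzD1 floor_lt_int//.
  by rewrite intrD ltrD2r -[ltRHS]mulr1 ltr_pM2l.
by case: absz => [|n] //=.
Qed.

(** The second condition on h says that it preserves midpoints, as needed to go
    through the average of the two order statistics. *)
Lemma quantile_comp (h : R -> R) x : {homo h : u v / u <= v} ->
  (forall u v, h u + h v = h ((u + v) / 2) *+ 2) ->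
  quantile alpha (h \o x) = h (quantile alpha x).
Proof.
move=> hh haff; rewrite /quantile !order_stat_comp ?ceil_index_lt
  ?floor_index_lt//.
by rewrite haff -[h _ *+ 2]mulr_natr mulfK// pnatr_eq0.
Qed.

Lemma quantile_affine (a c : R) x : 0 <= a ->
  quantile alpha (fun i => a * (x i - c)) = a * (quantile alpha x - c).
Proof.
move=> a0; apply: (quantile_comp (h := fun t => a * (t - c))).
  by move=> u v uv; rewrite ler_wpM2l// lerD2r.
by move=> u v; rewrite -mulr_natr; field.
Qed.

Lemma quantile_cst (c : R) : quantile alpha (fun _ : 'I_k => c) = c.
Proof.
have := @quantile_comp (fun=> c) (fun=> c) (fun _ _ _ => lexx c).
by apply => u v; rewrite mulr2n.
Qed.

Lemma quantile_monotone x y : (forall i, x i <= y i) ->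
  quantile alpha x <= quantile alpha y.
Proof.
move=> xy; rewrite /quantile ler_pM2r ?invr_gt0// lerD//;
  exact: order_stat_monotone.
Qed.

(** The sample x lies below y shifted upwards by the total displacement, so
    monotonicity and translation equivariance apply. *)
Lemma quantile_le_sum x y :
  quantile alpha x <= quantile alpha y + \sum_i `|x i - y i|.
Proof.
set s := \sum_i _.
have -> : quantile alpha y + s = quantile alpha (fun i => y i + s).
  apply/esym/(quantile_comp (h := fun t => t + s)) => u v;
    first by rewrite lerD2r.
  by rewrite -mulr_natr; field.
apply: quantile_monotone => i; rewrite -lerBlDl (le_trans (ler_norm _))//.
by rewrite /s (bigD1 i)//= lerDl sumr_ge0.
Qed.

Lemma quantile_lipschitz x y :
  `|quantile alpha x - quantile alpha y| <= \sum_i `|x i - y i|.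
Proof.
rewrite ler_norml lerBlDl quantile_le_sum andbT lerNl opprB lerBlDl.
under eq_bigr do rewrite distrC.
exact: quantile_le_sum.
Qed.

End Quantile.

(** * Coordinates and quantiles in a Hamel basis *)

Section HamelCoordinates.
Variables (R : realType) (X : lmodType R) (I : choiceType) (b : I -> X).
Hypothesis hb : hamel_basis b.
Local Notation coord := (hamel_coord b).

Lemma finsupp_coord (x : X) : finsupp_fun (coord x).
Proof. by have [] := hamel_coordP x hb. Qed.

(** Reduces the sums over the whole index type, which have finite support, to a
    common finite set A where they can be added and exchanged. *)
Lemma hamel_expansion (c : I -> R) (A : set I) :
  finite_set A -> (forall l, c l != 0 -> A l) ->
  \sum_(l \in [set: I]) c l *: b l = \sum_(l \in A) c l *: b l.
Proof.
move=> fA cA; apply/esym/fsbig_widen => // l [_ /= nAl].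
have [->|/cA//] := eqVneq (c l) 0; by rewrite scale0r.
Qed.

Lemma coord_sum (c : I -> R) : finsupp_fun c ->
  coord (\sum_(l \in [set: I]) c l *: b l) = c.
Proof.
move=> fc; set x := \sum_(l \in _) _.
have [fd xd] := hamel_coordP x hb.
apply/funext => l; apply/eqP; rewrite -subr_eq0; apply/eqP.
pose A := [set l | coord x l != 0] `|` [set l | c l != 0].
have fA : finite_set A by rewrite finite_setU.
have eA : forall l, coord x l - c l != 0 -> A l.
  move=> i; apply: contra_neqP => /not_orP[/negP/negPn/eqP-> /negP/negPn/eqP->].
  by rewrite subrr.
apply: (hamel_free hb (c := fun l => coord x l - c l)).
  exact: sub_finite_set fA.
rewrite (hamel_expansion (A := A))//.
under eq_fsbigr do rewrite scalerBl.
have -> : \sum_(i \in A) (coord x i *: b i - c i *: b i) =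
   \sum_(i \in A) coord x i *: b i - \sum_(i \in A) c i *: b i.
  by rewrite !fsbig_finite//= big_split /= sumrN.
rewrite -!(hamel_expansion (A := A))// -?xd ?subrr// => i h; [right|left];
  exact: h.
Qed.

Lemma coord_affine (a : R) (x y : X) (l : I) :
  coord (a *: (x - y)) l = a * (coord x l - coord y l).
Proof.
have [fx xE] := hamel_coordP x hb.
have [fy yE] := hamel_coordP y hb.
pose A := [set l | coord x l != 0] `|` [set l | coord y l != 0].
have fA : finite_set A by rewrite finite_setU.
pose c l := a * (coord x l - coord y l).
have cA : forall l, c l != 0 -> A l.
  move=> i; apply: contra_neqP => /not_orP[/negP/negPn/eqP e1 /negP/negPn/eqP
    e2].
  by rewrite /c e1 e2 subrr mulr0.
rewrite -[RHS]/(c l) -(@coord_sum c); last exact: sub_finite_set fA.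
congr coord; rewrite (hamel_expansion (A := A))//.
rewrite {1}xE {1}yE !(hamel_expansion (A := A))//; first last.
- by move=> i h; left.
- by move=> i h; right.
rewrite !fsbig_finite//= -sumrB scaler_sumr.
by apply: eq_bigr => i _; rewrite /c -scalerBl scalerA.
Qed.

Variables (alpha : I -> R) (k : nat).
Hypotheses (k0 : (0 < k)%N) (alpha01 : forall l, 0 < alpha l < 1).
Local Notation q := (@hamel_quantile R X I b alpha k).

Lemma coord_support_finite (x : 'I_k -> X) :
  finite_set (\bigcup_(i in [set: 'I_k]) [set l | coord (x i) l != 0]).
Proof. by apply: bigcup_finite => // i _; exact: finsupp_coord. Qed.

(** The quantile of a zero sample is zero, so the family of coordinate-wise
    quantiles is finitely supported and really is a family of coordinates. *)
Lemma coord_hamel_quantile (x : 'I_k -> X) (l : I) :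
  coord (q x) l = quantile (alpha l) (fun i => coord (x i) l).
Proof.
rewrite coord_sum//; apply: sub_finite_set (coord_support_finite x) => m /=.
apply: contra_neqP => nm.
rewrite (_ : (fun _ => _) = fun=> 0) ?quantile_cst//.
apply/funext => i; apply/eqP; apply: contrapT => /negP ci; apply: nm.
by exists i.
Qed.

Lemma hamel_coord_inj (x y : X) : coord x =1 coord y -> x = y.
Proof.
move=> /funext xy; have [_ ->] := hamel_coordP x hb.
by rewrite xy; have [_ <-] := hamel_coordP y hb.
Qed.

(** Centring and rescaling commute with the quantile, which turns the rescaled
    error of the estimator into the quantile of the rescaled block errors. *)
Lemma hamel_quantile_affine (a : R) (c : X) (x : 'I_k -> X) : 0 <= a ->
  q (fun i => a *: (x i - c)) = a *: (q x - c).
Proof.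
move=> a0; apply: hamel_coord_inj => l.
rewrite coord_hamel_quantile coord_affine coord_hamel_quantile.
by rewrite -quantile_affine//; congr quantile; apply/funext => i;
  rewrite coord_affine.
Qed.

Lemma hamel_quantile_cst (c : X) : q (fun=> c) = c.
Proof.
by apply: hamel_coord_inj => l; rewrite coord_hamel_quantile quantile_cst.
Qed.

(** This is where the l1 norm matters: the univariate bounds add up over the
    coordinates to the norms of the displacements. *)
Lemma hamel_quantile_lipschitz (x y : 'I_k -> X) :
  hamel_norm b (q x - q y) <= \sum_i hamel_norm b (x i - y i).
Proof.
have coordB (u v : X) l : coord (u - v) l = coord u l - coord v l.
  by rewrite -[u - v]scale1r coord_affine mul1r.
pose A := (\bigcup_(i in [set: 'I_k]) [set l | coord (x i) l != 0]) `|`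
  (\bigcup_(i in [set: 'I_k]) [set l | coord (y i) l != 0]).
have fA : finite_set A by rewrite finite_setU; split;
  exact: coord_support_finite.
have nA (x0 : X) : (forall l, coord x0 l != 0 -> A l) ->
    hamel_norm b x0 = \sum_(l \in A) `|coord x0 l|.
  move=> h; apply/esym/fsbig_widen => // l [_ /= nAl].
  by have [->|/h//] := eqVneq (coord x0 l) 0; rewrite normr0.
have outA l : ~ A l -> forall i, coord (x i) l = 0 /\ coord (y i) l = 0.
  move=> nAl i; split; apply/eqP; apply: contrapT => /negP h; apply: nAl.
    by left; exists i.
  by right; exists i.
rewrite nA; last first.
  move=> l; apply: contra_neqP => /outA h.
  rewrite coordB !coord_hamel_quantile.
  rewrite (_ : (fun i => _) = fun i => coord (y i) l) ?subrr//.
  by apply/funext => i; have [-> ->] := h i.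
under [leRHS]eq_bigr => i _.
  rewrite nA; last first.
    by move=> l; apply: contra_neqP => /outA/(_ i)[e1 e2];
      rewrite coordB e1 e2 subrr.
  rewrite fsbig_finite//; over.
rewrite exchange_big /= fsbig_finite//; apply: ler_sum => l _.
rewrite coordB !coord_hamel_quantile (le_trans (quantile_lipschitz k0 (alpha01
  l) _ _))//.
by apply: ler_sum => i _; rewrite coordB.
Qed.

End HamelCoordinates.

(** * Measurability for random elements of a nonseparable space *)

Section RandomElements.
Variables (d : measure_display) (T : measurableType d) (R : realType).
Variable X : normedModType R.

Lemma random_element_dense (f : T -> X) : random_element f ->
  exists y : nat -> X, forall w e, 0 < e -> exists n, `|f w - y n| < e.
Proof.
move=> [_ [D /countable_injP[g injg] fD]].
exists (fun n => xget 0 [set x | D x /\ g x = n]) => w e e0.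
have /fD/(_ (ball (f w) e) (nbhsx_ballx _ _ e0))[x [Dx]] : range f (f w).
  by exists w.
rewrite -ball_normE /= => fx; exists (g x).
case: xgetP => [x' _ [Dx' gx']|/(_ x)]; last by case.
by rewrite (injg x' x)// inE.
Qed.

Lemma random_element_ball (f : T -> X) (y : X) (r : R) : random_element f ->
  measurable [set w | `|f w - y| < r].
Proof.
move=> [mf _]; have := mf measurableT (ball y r).
rewrite setTI (_ : f @^-1` _ = [set w | `|f w - y| < r]); last first.
  by apply/seteqP; split=> w /=; rewrite -ball_normE /= distrC.
apply; apply: sub_sigma_algebra; exact: ball_open.
Qed.

Variable k : nat.

(** Openness for the product topology on k-tuples, stated with balls. *)
Definition coordwise_open (O : set ('I_k -> X)) :=
  forall x, O x -> exists2 r : R, 0 < r &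
    forall y, (forall i, `|x i - y i| < r) -> O y.

(** The Borel sigma-algebra of a product may be larger than the product of the
    Borel sigma-algebras.  For random elements this does not matter: along
    their ranges an open set is a countable union of boxes centred at points of
    dense sequences. *)
Lemma measurable_coordwise_open (V : 'I_k -> T -> X) (O : set ('I_k -> X)) :
  (forall i, random_element (V i)) -> coordwise_open O ->
  measurable [set w | O (fun i => V i w)].
Proof.
move=> hV hO.
have [y yV] := choice (fun i => random_element_dense (hV i)).
pose inO (p : {ffun 'I_k -> nat} * nat) :=
  forall x, (forall i, `|x i - y i (p.1 i)| < p.2.+1%:R^-1) -> O x.
(* A box counts only if it is contained in O; the choice of J and of the radius
   ranges over a countable type. *)
pose box p := if pselect (inO p) then
  \bigcap_i [set w | `|V i w - y i (p.1 i)| < p.2.+1%:R^-1] else set0.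
rewrite (_ : [set w | _] = \bigcup_p box p).
  apply: countable_bigcupT_measurable => [|p]; first exact: countableP.
  rewrite /box; case: (pselect _) => [Op|nOp] //=;
    apply: fin_bigcap_measurable => //.
  by move=> i _; exact: random_element_ball.
apply/seteqP; split => [w /= Ow|w [p _]]; last first.
  by rewrite /box; case: (pselect _) => [Op|nOp] //= h; apply: Op => i;
    exact: h.
have [r r0 hr] := hO _ Ow.
(* Half the radius: a box containing V w whose side is below r / 2 stays within
   distance r of V w. *)
have [n nr] : exists n, n.+1%:R^-1 < r / 2.
  have r2 : 0 < r / 2 by rewrite divr_gt0.
  exists (Num.truncn (r / 2)^-1).
  rewrite -ltf_pV2 ?posrE ?invr_gt0 ?invrK//; exact: truncnS_gt.
have [J hJ] := choice (fun i => yV i w n.+1%:R^-1 (ltac:(by rewrite invr_gt0))).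
exists ([ffun i => J i], n) => //; rewrite /box;
  case: (pselect _) => [Op|nOp] /=.
  by move=> i _ /=; rewrite ffunE; exact: hJ.
case: nOp => x /= hx; apply: hr => i.
rewrite -(subrK (y i (J i)) (V i w)) -addrA (le_lt_trans (ler_normD _ _))//.
rewrite [ltRHS]splitr ltrD// (lt_trans _ nr)// ?hJ// distrC.
by have := hx i; rewrite ffunE.
Qed.

Lemma l1_dist_lt (L e : R) : 0 <= L -> 0 < e -> exists2 r : R, 0 < r &
  forall x y : 'I_k -> X, (forall i, `|x i - y i| < r) ->
    L * \sum_i `|x i - y i| < e.
Proof.
move=> L0 e0; have D0 : 0 < L * k%:R + 1 by rewrite ltr_pwDr// mulr_ge0.
exists (e / (L * k%:R + 1)) => [|x y xy]; first by rewrite divr_gt0.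
have : L * \sum_i `|x i - y i| <= L * (k%:R * (e / (L * k%:R + 1))).
  rewrite ler_wpM2l// mulr_natl -[X in _ *+ X]card_ord -sumr_const.
  by apply: ler_sum => i _; exact/ltW.
move=> /le_lt_trans; apply.
rewrite (_ : L * _ = L * k%:R * e / (L * k%:R + 1)); last by ring.
by rewrite ltr_pdivrMr// mulrDr mulr1 [e * _]mulrC ltrDl.
Qed.

Lemma measurable_lipschitz_comp (Z : normedModType R) (L : R)
    (F : ('I_k -> X) -> Z) (V : 'I_k -> T -> X) : 0 <= L ->
  (forall x y, `|F x - F y| <= L * \sum_i `|x i - y i|) ->
  (forall i, random_element (V i)) ->
  measurable_fun [set: T] ((fun w => F (V ^~ w)) : T -> borel Z).
Proof.
move=> L0 FL rV.
apply: (@measurability _ _ _ (borel Z) _ _ (@open Z)) => // _ [B oB <-].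
apply: measurableI => //.
apply: (measurable_coordwise_open (O := [set x | B (F x)]) rV) => x Bx.
have /nbhs_ballP[e /= e0 he] : nbhs (F x) B by exact: open_nbhs_nbhs.
have [r r0 hr] := l1_dist_lt L0 e0.
exists r => // y xy; apply: he; rewrite -ball_normE /=.
exact: le_lt_trans (FL _ _) (hr _ _ xy).
Qed.

End RandomElements.

(** * Independent copies of a random element *)

Section IndependentCopies.
Variables (R : realType) (d0 d1 ds : measure_display).
Variables (T0 : measurableType d0) (T : measurableType d1).
Variable S : measurableType ds.
Variables (P0 : probability T0 R) (P : probability T R) (k : nat).

(** One product formula for independence together with a common law; setting all
    sets but one to the full space recovers the marginal laws. *)
Definition independent_copies (V : 'I_k -> T -> S) (V0 : T0 -> S) :=
  forall C : 'I_k -> set S, (forall i, measurable (C i)) ->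
    P (\bigcap_i V i @^-1` C i) = (\prod_i P0 (V0 @^-1` C i))%E.

(** The pi-lambda theorem, one coordinate at a time.  By induction on r, the
    formula holds when the first r sets are arbitrary and the others are in G:
    as functions of the r-th set both sides are finite measures, which agree on
    the pi-system G. *)
Lemma independent_copies_gen (V : 'I_k -> T -> S) (V0 : T0 -> S)
    (G : set (set S)) :
  (forall i, measurable_fun [set: T] (V i)) -> measurable_fun [set: T0] V0 ->
  @measurable _ S = <<s G >> -> setI_closed G -> G [set: S] ->
  (forall C : 'I_k -> set S, (forall i, G (C i)) ->
    P (\bigcap_i V i @^-1` C i) = (\prod_i P0 (V0 @^-1` C i))%E) ->
  independent_copies V V0.
Proof.
move=> mV mV0 SG GI GT hG.
have Gm A : G A -> measurable A by rewrite SG; exact: sub_sigma_algebra.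
suff H r (C : 'I_k -> set S) : (forall i, measurable (C i)) ->
    (forall i : 'I_k, (r <= i)%N -> G (C i)) ->
    P (\bigcap_i V i @^-1` C i) = (\prod_i P0 (V0 @^-1` C i))%E.
  by move=> C mC; apply: (H k) => // i; rewrite leqNgt ltn_ord.
elim: r C => [|r IH] C mC GC; first by apply: hG => i; exact: GC.
have [kr|rk] := leqP k r.
  by apply: IH => // i ri; have := leq_trans kr ri; rewrite leqNgt ltn_ord.
pose i0 := Ordinal rk.
(* D and c gather the coordinates other than i0, which are kept fixed. *)
pose D : set T := \bigcap_(i in [set i | i != i0]) V i @^-1` C i.
have mVi i A : measurable A -> measurable (V i @^-1` A).
  by move=> mA; rewrite -[X in measurable X]setTI; exact: mV.
have mV0i A : measurable A -> measurable (V0 @^-1` A).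
  by move=> mA; rewrite -[X in measurable X]setTI; exact: mV0.
have mD : measurable D by apply: fin_bigcap_measurable => [|i _];
  [exact: finite_finset|exact: mVi].
pose c := \prod_(i | i != i0) fine (P0 (V0 @^-1` C i)).
have c0 : 0 <= c by apply: prodr_ge0 => i _; exact: fine_ge0.
pose m1_ : {measure set S -> \bar R} := pushforward (mrestr P mD) (V i0).
pose m1 := m1_ (mV i0).
pose m2_ : {measure set S -> \bar R} := mscale (NngNum c0) (pushforward P0 V0).
pose m2 := m2_ mV0.
pose CB B i := if i == i0 then B else C i.
have m1E B : m1 B = P (\bigcap_i V i @^-1` CB B i).
  rewrite /m1 /= /pushforward /mrestr; congr (P _); apply/seteqP; split.
    move=> w [Bw Dw] i _; rewrite /CB /preimage /=;
      case: eqP => [->//|/eqP ii0].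
    exact: Dw.
  move=> w h; split; first by have := h i0 I; rewrite /CB /preimage /= eqxx.
  move=> i /= ii0; have := h i I; rewrite /CB /preimage /= (negbTE ii0)//.
have m2E B : measurable B -> m2 B = (\prod_i P0 (V0 @^-1` CB B i))%E.
  move=> mB; rewrite /m2 /= /mscale /= /pushforward.
  rewrite (bigD1 i0)//= /CB eqxx muleC; congr (_ * _)%E.
  rewrite /c -prodEFin; apply: eq_bigr => i ii0; rewrite (negbTE ii0).
  by rewrite fineK// fin_num_measure//; exact: mV0i.
have -> : \bigcap_i V i @^-1` C i = \bigcap_i V i @^-1` CB (C i0) i.
  by apply: eq_bigcapr => i _; rewrite /CB; case: eqP => [->|].
rewrite -m1E.
have -> : (\prod_i P0 (V0 @^-1` C i) = \prod_i P0 (V0 @^-1` CB (C i0) i))%E.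
  by apply: eq_bigr => i _; rewrite /CB; case: eqP => [->|].
rewrite -m2E//.
apply: (measure_unique G (fun=> setT)) => //.
- by rewrite -subTset => x _; exists 0%N.
- move=> B GB; rewrite m1E m2E; last exact: Gm.
  apply: IH => [i|i ri]; rewrite /CB; case: eqP => [_|ii0] //; first exact: Gm.
  apply: GC; rewrite ltn_neqAle ri andbT; apply: contra_notN ii0 => /eqP ri0.
  exact/val_inj.
- move=> _; rewrite m1E (le_lt_trans (probability_le1 _ _)) ?ltry//.
  apply: fin_bigcap_measurable => [|i _]; first exact: finite_finset.
  by apply: mVi; rewrite /CB; case: ifP.
Qed.

End IndependentCopies.

(** * Blocks of an i.i.d. sample *)

Section Blocks.
Variables (R : realType) (d dE : measure_display).
Variables (T : measurableType d) (E : measurableType dE).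
Variables (P : probability T R) (m : nat).

(** Independence is defined with finite subsets of the index type; for the
    blocks, families indexed by pairs (block, position) are more convenient. *)
Lemma mutually_independent_inj (J : choiceType) (V : J -> T -> E)
    (K : finType) (f : K -> J) (A : K -> set E) :
  mutually_independent P V -> injective f -> (forall p, measurable (A p)) ->
  P (\bigcap_p V (f p) @^-1` A p) = (\prod_p P (V (f p) @^-1` A p))%E.
Proof.
move=> indV injf mA.
(* As f is injective, A' j is A p when j = f p, and the full space when j is
   outside the image of f. *)
pose A' j := \bigcap_(p in [set p | f p = j]) A p.
have A'f p : A' (f p) = A p.
  by apply/seteqP; split=> [x /(_ p erefl) //|x Ax q /= /injf ->].
have mA' j : measurable (A' j).
  by apply: fin_bigcap_measurable => [|i _] //; exact: finite_finset.
have := indV [fset f p | p in K]%fset A' mA'.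
rewrite big_imfset /=; last by move=> p q _ _; exact: injf.
rewrite big_enum /= => indS.
under [RHS]eq_bigr do rewrite -A'f.
rewrite [RHS](eq_bigl (fun p => p \in K)) // -indS.
congr (P _); apply/seteqP; split=> [w h j /= /imfsetP[p _ ->]|w h p _].
  by rewrite /preimage /= A'f; exact: h.
have := h (f p); rewrite /preimage /= A'f; apply.
by apply/imfsetP; exists p.
Qed.

Definition tuple_rectangles : set (set (m.-tuple E)) :=
  [set [set t | forall j, A j (tnth t j)] |
     A in [set A : 'I_m -> set E | forall j, measurable (A j)]].

Lemma tuple_rectangles_setI : setI_closed tuple_rectangles.
Proof.
move=> _ _ [A mA <-] [B mB <-]; exists (fun j => A j `&` B j).
  by move=> j; apply: measurableI; [exact: mA|exact: mB].
apply/seteqP; split=> t /=; first by move=> h; split=> j; have [] := h j.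
by move=> [hA hB] j; split; [exact: hA|exact: hB].
Qed.

Lemma tuple_rectangles_setT : tuple_rectangles [set: m.-tuple E].
Proof.
exists (fun=> setT) => //.
by apply/seteqP; split.
Qed.

Lemma measurable_tuple_rectangles :
  @measurable _ (m.-tuple E) = <<s tuple_rectangles >>.
Proof.
apply/seteqP; split.
  apply: smallest_sub; first exact: smallest_sigma_algebra.
  rewrite -bigcup_seq; apply: bigcup_sub => j _ _ [A mA <-].
  apply: sub_sigma_algebra; exists (fun i => if i == j then A else setT) => /=.
    by move=> i; case: ifP.
  rewrite setTI; apply/seteqP; split=> t /=; first by move=> /(_ j);
    rewrite eqxx.
  by move=> h i; case: eqP => // ->.
apply: smallest_sub; first exact: sigma_algebra_measurable.
move=> _ [A mA <-].
rewrite (_ : [set t | _] = \bigcap_j ((@tnth _ E ^~ j) @^-1` A j)); last first.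
  by apply/seteqP; split=> t h j; [move=> _|]; exact: h.
apply: fin_bigcap_measurable => [|j _]; first exact: finite_finset.
rewrite -[X in measurable X]setTI; apply: measurable_tnth => //; exact: mA.
Qed.

(** On rectangles both sides are products over pairs (block, position) of
    probabilities that involve one observation only. *)
Lemma iid_blocks (xi : nat -> T -> E) (k n : nat)
    (blk : 'I_k * 'I_m -> 'I_n) : iid P xi -> injective blk ->
  independent_copies P P (fun i w => [tuple xi (blk (i, j)) w | j < m])
                         (fun w => [tuple xi j w | j < m]).
Proof.
move=> [mxi indxi eqxi] injblk.
apply: (independent_copies_gen (G := tuple_rectangles)).
- move=> i; apply/measurable_fun_tnthP => j.
  by rewrite (_ : _ \o _ = xi (blk (i, j)))//; apply/funext => w /=;
    rewrite tnth_mktuple.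
- apply/measurable_fun_tnthP => j.
  by rewrite (_ : _ \o _ = xi j)//; apply/funext => w /=; rewrite tnth_mktuple.
- exact: measurable_tuple_rectangles.
- exact: tuple_rectangles_setI.
- exact: tuple_rectangles_setT.
move=> C hC.
have {hC} /choice[A] : forall i, exists A : 'I_m -> set E,
    (forall j, measurable (A j)) /\ C i = [set t | forall j, A j (tnth t j)].
  by move=> i; have [A mA <-] := hC i; exists A.
move=> /all_and2[mA CE].
rewrite (_ : \bigcap_i _ = \bigcap_p xi (blk p) @^-1` A p.1 p.2); last first.
  apply/seteqP; split=> [w h [i j] _|w h i _]; rewrite /preimage /=.
    by have := h i I; rewrite /preimage /= CE => /(_ j); rewrite tnth_mktuple.
  by rewrite CE => j; rewrite tnth_mktuple; exact: (h (i, j)).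
rewrite (@mutually_independent_inj _ xi _ (fun p => blk p)) //; last first.
  by move=> p q /= /val_inj/injblk.
transitivity (\prod_p P (xi (blk (p.1, p.2)) @^-1` A p.1 p.2))%E.
  by apply: eq_bigr => -[].
rewrite -(pair_bigA _ (fun i j => P (xi (blk (i, j)) @^-1` A i j)))/=.
apply: eq_bigr => i _.
rewrite (_ : (fun w => _) @^-1` C i = \bigcap_(j : 'I_m) xi j @^-1` A i j);
  last first.
  rewrite CE; apply/seteqP; split=> w h j; rewrite /preimage /=.
    by have := h j; rewrite tnth_mktuple.
  by rewrite tnth_mktuple; exact: h.
rewrite (@mutually_independent_inj _ xi _ (fun j : 'I_m => nat_of_ord j)) //;
  last exact: val_inj.
by apply: eq_bigr => j _; exact: eqxi.
Qed.

End Blocks.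

(** * Expectations of bounded random variables *)

Section Expectations.
Variables (R : realType) (d : measure_display) (T : measurableType d).
Variable P : probability T R.
Implicit Types f g : T -> R.

Definition bounded_rv f :=
  measurable_fun [set: T] f /\ exists M, forall w, `|f w| <= M.

Lemma bounded_rv_integrable f : bounded_rv f -> P.-integrable setT (EFin \o f).
Proof.
move=> [mf [M hM]]; apply: measurable_bounded_integrable => //.
  by rewrite (le_lt_trans (probability_le1 P measurableT)) ?ltry.
exists M; split; first exact: num_real.
by move=> x Mx w _ /=; rewrite (le_trans (hM w))// ltW.
Qed.

Lemma expectationE f : bounded_rv f -> ('E_P[f] = (expect P f)%:E)%E.
Proof.
move=> bf; rewrite unlock /Rintegral fineK//.
exact/integrable_fin_num/bounded_rv_integrable.
Qed.

Lemma bounded_rv_cst c : bounded_rv (fun=> c).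
Proof. by split=> //; exists `|c|. Qed.

Lemma bounded_rvD f g :
  bounded_rv f -> bounded_rv g -> bounded_rv (fun w => f w + g w).
Proof.
move=> [mf [M hM]] [mg [N hN]]; split; first exact: measurable_funD.
by exists (M + N) => w; rewrite (le_trans (ler_normD _ _))// lerD.
Qed.

Lemma bounded_rvM f g :
  bounded_rv f -> bounded_rv g -> bounded_rv (fun w => f w * g w).
Proof.
move=> [mf [M hM]] [mg [N hN]]; split; first exact: measurable_funM.
by exists (M * N) => w; rewrite normrM ler_pM.
Qed.

Lemma bounded_rvB f g :
  bounded_rv f -> bounded_rv g -> bounded_rv (fun w => f w - g w).
Proof.
move=> [mf [M hM]] [mg [N hN]]; split; first exact: measurable_funB.
by exists (M + N) => w; rewrite (le_trans (ler_normB _ _))// lerD.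
Qed.

Lemma bounded_rv_sum (K : finType) (f : K -> T -> R) :
  (forall i, bounded_rv (f i)) -> bounded_rv (fun w => \sum_i f i w).
Proof.
move=> bf; elim: (index_enum K) => [|i s IH].
  by under eq_fun do rewrite big_nil; exact: bounded_rv_cst.
by under eq_fun do rewrite big_cons; exact: bounded_rvD.
Qed.

Lemma bounded_rv_prod (K : finType) (f : K -> T -> R) :
  (forall i, bounded_rv (f i)) -> bounded_rv (fun w => \prod_i f i w).
Proof.
move=> bf; elim: (index_enum K) => [|i s IH].
  by under eq_fun do rewrite big_nil; exact: bounded_rv_cst.
by under eq_fun do rewrite big_cons; exact: bounded_rvM.
Qed.

Lemma bounded_rv_indic (A : set T) : measurable A -> bounded_rv (\1_A).
Proof.
move=> mA; split; first exact: measurable_indic.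
by exists 1 => w; rewrite indicE ger0_norm// lern1 leq_b1.
Qed.

Lemma expect_cst c : expect P (fun=> c) = c.
Proof. by rewrite Rintegral_cst//= probability_setT /= mulr1. Qed.

Lemma expectD f g : bounded_rv f -> bounded_rv g ->
  expect P (fun w => f w + g w) = expect P f + expect P g.
Proof. by move=> bf bg; rewrite RintegralD//; exact: bounded_rv_integrable. Qed.

Lemma expectZ c f : bounded_rv f ->
  expect P (fun w => c * f w) = c * expect P f.
Proof. by move=> bf; rewrite RintegralZl//; exact: bounded_rv_integrable. Qed.

Lemma expect_sum (K : finType) (f : K -> T -> R) :
  (forall i, bounded_rv (f i)) ->
  expect P (fun w => \sum_i f i w) = \sum_i expect P (f i).
Proof.
move=> bf.
suff H (s : seq K) : bounded_rv (fun w => \sum_(i <- s) f i w) /\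
    expect P (fun w => \sum_(i <- s) f i w) = \sum_(i <- s) expect P (f i).
  by have [] := H (index_enum K).
elim: s => [|i s [bs IH]].
  under eq_fun do rewrite big_nil; rewrite big_nil expect_cst; split=> //.
  exact: bounded_rv_cst.
under eq_fun do rewrite big_cons; rewrite big_cons expectD// IH; split=> //.
exact: bounded_rvD.
Qed.

Lemma expectB f g : bounded_rv f -> bounded_rv g ->
  expect P (fun w => f w - g w) = expect P f - expect P g.
Proof. by move=> bf bg; rewrite RintegralB//; exact: bounded_rv_integrable. Qed.

Lemma le_expect f g : bounded_rv f -> bounded_rv g -> (forall w, f w <= g w) ->
  expect P f <= expect P g.
Proof. by move=> bf bg fg; apply: le_Rintegral => //;
  exact: bounded_rv_integrable. Qed.

Lemma ler_expect_dist f g h : bounded_rv f -> bounded_rv g -> bounded_rv h ->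
  (forall w, `|f w - g w| <= h w) -> `|expect P f - expect P g| <= expect P h.
Proof.
move=> bf bg bh fgh.
rewrite ler_norml lerBlDl lerNl opprB lerBlDr -!expectD//.
apply/andP; split; apply: le_expect => //; try exact: bounded_rvD.
  by move=> w; have := fgh w; rewrite ler_norml => /andP[]; lra.
by move=> w; have := fgh w; rewrite ler_norml => /andP[]; lra.
Qed.

Lemma expect_indic (A : set T) : measurable A -> expect P (\1_A) = fine (P A).
Proof. by move=> mA; rewrite /Rintegral integral_indic// setIT. Qed.

End Expectations.

(** * Expectations of products of independent factors *)

Section Products.
Variables (R : realType).

Lemma normr_unit_itv (t : R) : 0 <= t <= 1 -> `|t| <= 1.
Proof. by move=> /andP[t0 t1]; rewrite ger0_norm. Qed.

Lemma unit_itv_onem (t : R) : 0 <= t <= 1 -> 0 <= 1 - t <= 1.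
Proof. by move=> /andP[t0 t1]; rewrite subr_ge0 t1 gerBl. Qed.

Lemma prod_unit_itv (K : Type) (s : seq K) (a : K -> R) :
  (forall i, 0 <= a i <= 1) -> 0 <= \prod_(i <- s) a i <= 1.
Proof.
move=> a01; elim: s => [|i s /andP[p0 p1]]; first by rewrite big_nil ler01 lexx.
have /andP[a0 a1] := a01 i.
by rewrite big_cons mulr_ge0//= mulr_ile1.
Qed.

Lemma ler_dist_prod (K : Type) (s : seq K) (a b : K -> R) :
  (forall i, 0 <= a i <= 1) -> (forall i, 0 <= b i <= 1) ->
  `|\prod_(i <- s) a i - \prod_(i <- s) b i| <= \sum_(i <- s) `|a i - b i|.
Proof.
move=> a01 b01; elim: s => [|i s IH]; first by rewrite !big_nil subrr normr0.
rewrite !big_cons; have /andP[a0 a1] := a01 i.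
have /andP[p0 p1] := @prod_unit_itv _ s _ b01.
rewrite (_ : _ - _ = a i * (\prod_(j <- s) a j - \prod_(j <- s) b j) +
   (a i - b i) * \prod_(j <- s) b j); last by ring.
rewrite (le_trans (ler_normD _ _))// addrC lerD// normrM.
  by rewrite ler_piMr// ger0_norm.
by rewrite (le_trans _ IH)// ler_piMl// ger0_norm.
Qed.

(** The largest multiple of 1 / n below t, for t in the unit interval; it is
    written with indicators of superlevel sets so that composing it with a
    measurable function gives a simple function. *)
Definition staircase (n : nat) (t : R) : R :=
  \sum_(j < n) n%:R^-1 * (j.+1%:R / n%:R <= t)%R%:R.

Lemma staircase_approx n t : 0 <= t <= 1 -> (0 < n)%N ->
  `|t - staircase n t| <= n%:R^-1.
Proof.
move=> /andP[t0 t1] n0; have nR : 0 < n%:R :> R by rewrite ltr0n.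
have tn0 : 0 <= t * n%:R by rewrite mulr_ge0// ltW.
have -> : staircase n t = (Num.truncn (t * n%:R))%:R / n%:R.
  rewrite /staircase -mulr_sumr mulrC; congr (_ / _).
  rewrite -natr_sum; congr (_%:R).
  have mn : (Num.truncn (t * n%:R) <= n)%N.
    by rewrite -(ler_nat R) (le_trans (_ : _ <= t * n%:R)) ?truncn_le//
      ler_piMl// ltW.
  transitivity (\sum_(j < n) (j < Num.truncn (t * n%:R))%N : nat)%N.
    by apply: eq_bigr => j _; rewrite truncn_gt_nat ler_pdivrMr.
  rewrite -[RHS]card_ord -sum1_card (big_ord_widen n (fun=> 1%N) mn)
    [RHS]big_mkcond.
  by apply: eq_bigr => j _; case: ifP.
have /andP[h1 h2] := truncn_itv tn0.
set m := Num.truncn _ in h1 h2 *.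
have -> : t - m%:R / n%:R = (t * n%:R - m%:R) / n%:R by field; rewrite gt_eqF.
have ni0 : 0 <= n%:R^-1 :> R by rewrite invr_ge0 ltW.
rewrite normrM (ger0_norm ni0) ler_piMl//.
by rewrite ger0_norm ?subr_ge0// lerBlDl natr1 ltW.
Qed.

End Products.

Section IndependentExpectations.
Variables (R : realType) (d0 d1 ds : measure_display).
Variables (T0 : measurableType d0) (T : measurableType d1).
Variable S : measurableType ds.
Variables (P0 : probability T0 R) (P : probability T R) (k : nat).
Variables (V : 'I_k -> T -> S) (V0 : T0 -> S).
Hypotheses (mV : forall i, measurable_fun [set: T] (V i)).
Hypothesis (mV0 : measurable_fun [set: T0] V0).
Hypothesis indV : independent_copies P0 P V V0.


Lemma prod_indic (C : 'I_k -> set T) w :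
  \prod_i \1_(C i) w = \1_(\bigcap_i C i) w :> R.
Proof.
rewrite [RHS]indicE; have [/set_mem wC|/negP wC] := boolP (w \in _).
  by rewrite big1// => i _; rewrite indicE mem_set//; exact: wC.
have [i wi] : exists i, ~ C i w.
  by apply/existsNP => h; apply: wC; rewrite inE => i _; exact: h.
by rewrite (bigD1 i)//= indicE memNset// mul0r.
Qed.

(** Both sides expand by distributivity into a sum over the choices J of one
    level per coordinate, and match term by term. *)
Lemma expect_prod_simple n (A : 'I_k -> 'I_n -> set S) (c : R) :
  (forall i j, measurable (A i j)) ->
  expect P (fun w => \prod_i \sum_j c * \1_(A i j) (V i w)) =
  \prod_i expect P0 (fun w => \sum_j c * \1_(A i j) (V0 w)).
Proof.
move=> mA.
have mVA i j : measurable (V i @^-1` A i j).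
  by rewrite -[X in measurable X]setTI; exact: mV.
have mV0A i j : measurable (V0 @^-1` A i j).
  by move: mV0 => /(_ measurableT _ (mA i j)); rewrite setTI.
transitivity (expect P (fun w => \sum_(J : {ffun 'I_k -> 'I_n})
    c ^+ k * \1_(\bigcap_i V i @^-1` A i (J i)) w)).
  congr (expect P _); apply/funext => w; rewrite bigA_distr_bigA;
    apply: eq_bigr => J _.
  by rewrite big_split /= prodr_const card_ord -prod_indic.
have mcap (J : {ffun 'I_k -> 'I_n}) : measurable (\bigcap_i V i @^-1` A i (J
  i)).
  by apply: fin_bigcap_measurable => [|i _] //; exact: finite_finset.
have bI (J : {ffun 'I_k -> 'I_n}) := bounded_rv_indic R (mcap J).
rewrite expect_sum; last by move=> J; apply: bounded_rvM => //;
  exact: bounded_rv_cst.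
have bI0 i j := bounded_rv_indic R (mV0A i j).
under [RHS]eq_bigr => i _.
  rewrite expect_sum; last by move=> j; apply: bounded_rvM (bI0 i j);
    exact: bounded_rv_cst.
  over.
rewrite bigA_distr_bigA; apply: eq_bigr => J _.
rewrite expectZ// expect_indic// indV; last by move=> i; exact: mA.
under [RHS]eq_bigr => i _ do rewrite (expectZ P0 c (bI0 i (J i)))
  expect_indic//.
rewrite big_split /= prodr_const card_ord; congr (_ * _).
elim: (index_enum _) => [|i s IH]; first by rewrite !big_nil.
rewrite !big_cons fineM ?IH//; first by rewrite fin_num_measure.
apply: (big_ind (fun x : \bar R => x \is a fin_num)) => // [x y|l _].
  exact: fin_numM.
by rewrite fin_num_measure.
Qed.

(** Staircases approximate each h i uniformly within 1 / n, so by
    [ler_dist_prod] each side of the identity changes by at most k / n when h is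
    replaced with its staircase, for which [expect_prod_simple] applies. *)
Lemma expect_prod_independent (h : 'I_k -> S -> R) :
  (forall i, measurable_fun [set: S] (h i)) ->
  (forall i s, 0 <= h i s <= 1) ->
  expect P (fun w => \prod_i h i (V i w)) =
  \prod_i expect P0 (fun w => h i (V0 w)).
Proof.
move=> mh h01; apply/eqP; rewrite -subr_eq0 -normr_le0;
  apply/ler_addgt0Pl => e e0.
rewrite addr0.
have [n /andP[n0 ne]] : exists n, (0 < n)%N && (n%:R^-1 * k%:R *+ 2 <= e).
  exists (Num.truncn (k%:R *+ 2 / e)).+1; rewrite ltn0Sn/=.
  rewrite -mulrnAr mulrC ler_pdivrMr ?ltr0n// mulrC -ler_pdivrMr//.
  by apply: ltW; exact: truncnS_gt.
pose A i (j : 'I_n) := [set s | j.+1%:R / n%:R <= h i s].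
have mA i j : measurable (A i j).
  rewrite -[A i j]setTI (_ : A i j = h i @^-1` `[j.+1%:R / n%:R, +oo[%classic).
    by apply: mh.
  by apply/seteqP; split=> s /=; rewrite in_itv/= andbT.
pose st i s := staircase n (h i s).
have stE i s : st i s = \sum_j n%:R^-1 * \1_(A i j) s.
  apply: eq_bigr => j _; rewrite indicE; congr (_ * (nat_of_bool _)%:R);
    apply/idP/idP.
    by move=> ?; rewrite mem_set.
  by move/set_mem.
have st01 i s : 0 <= st i s <= 1.
  apply/andP; split; first by apply: sumr_ge0 => j _;
    rewrite mulr_ge0// invr_ge0.
  apply: (@le_trans _ _ (\sum_(j < n) n%:R^-1)).
    by apply: ler_sum => j _; rewrite ler_piMr ?invr_ge0// lern1 leq_b1.
  by rewrite sumr_const card_ord -[_ *+ n]mulr_natr mulVf// pnatr_eq0 -lt0n.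
have sth i s : `|h i s - st i s| <= n%:R^-1 by exact: staircase_approx.
have bh dT (T' : measurableType dT) (f : T' -> S) i :
    measurable_fun setT f -> bounded_rv (fun w => h i (f w)).
  move=> mf; split; first exact: measurableT_comp.
  by exists 1 => w; exact/normr_unit_itv/h01.
have bst dT (T' : measurableType dT) (f : T' -> S) i :
    measurable_fun setT f -> bounded_rv (fun w => st i (f w)).
  move=> mf; split; last first.
    by exists 1 => w; exact/normr_unit_itv/st01.
  apply: (measurableT_comp (f := st i)) => //.
  rewrite (_ : st i = fun s => \sum_j n%:R^-1 * \1_(A i j) s);
    last exact/funext.
  by apply: measurable_sum => j; apply: measurable_funM => //;
    exact: measurable_indic.
have Est : expect P (fun w => \prod_i st i (V i w)) =
    \prod_i expect P0 (fun w => st i (V0 w)).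
  transitivity (expect P (fun w => \prod_i \sum_j n%:R^-1 * \1_(A i j) (V i
    w))).
    by congr (expect P _); apply/funext => w; apply: eq_bigr => i _;
      rewrite stE.
  rewrite expect_prod_simple//; apply: eq_bigr => i _; congr (expect P0 _).
  by apply/funext => w; rewrite stE.
rewrite -(subrK (expect P (fun w => \prod_i st i (V i w))) (expect P _)) -addrA.
rewrite (le_trans _ ne)// mulr2n (le_trans (ler_normD _ _))// lerD//.
  rewrite -[leRHS](expect_cst P); apply: ler_expect_dist.
  - by apply: bounded_rv_prod => i; exact: bh.
  - by apply: bounded_rv_prod => i; exact: bst.
  - exact: bounded_rv_cst.
  - move=> w; rewrite (le_trans (ler_dist_prod _ _ _))//.
    rewrite (le_trans (ler_sum _ (fun i _ => sth i (V i w))))//.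
    by rewrite sumr_const card_ord mulr_natr.
have expect01 (f : T0 -> R) : bounded_rv f -> (forall w, 0 <= f w <= 1) ->
    0 <= expect P0 f <= 1.
  move=> bf f01; rewrite -[X in _ <= _ <= X](expect_cst P0) -[X in X <=
    _](expect_cst P0).
  apply/andP; split; apply: le_expect => //; try exact: bounded_rv_cst.
    by move=> w; have /andP[] := f01 w.
  by move=> w; have /andP[] := f01 w.
rewrite Est distrC (le_trans (ler_dist_prod _ _ _))//.
- by move=> i; apply: expect01 => //; exact: bh.
- by move=> i; apply: expect01 => //; exact: bst.
rewrite (le_trans (ler_sum _ (G := fun=> n%:R^-1) _))//; last first.
  by rewrite sumr_const card_ord mulr_natr.
move=> i _; rewrite -[leRHS](expect_cst P0); apply: ler_expect_dist => //.
- exact: bh.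
- exact: bst.
- exact: bounded_rv_cst.
Qed.

End IndependentExpectations.

(** * A continuous partition of unity along a dense sequence *)

Section Convergence.
Variables (R : realType).

(** Dominated convergence, with a constant as the dominating function. *)
Lemma expect_bounded_cvg d (T : measurableType d) (P : probability T R)
    (f_ : nat -> T -> R) (f : T -> R) (M : R) :
  (forall n, measurable_fun setT (f_ n)) -> bounded_rv f ->
  (forall n w, `|f_ n w| <= M) ->
  (forall w, f_ n w @[n --> \oo] --> f w) ->
  expect P (f_ n) @[n --> \oo] --> expect P f.
Proof.
move=> mf_ bf fM f_f.
have bdd : {ae P, forall w n, setT w -> (`|(f_ n w)%:E| <= (cst M%:E) w)%E}.
  by apply: aeW => w n _; rewrite lee_fin.
have ff : {ae P, forall w, setT w -> (f_ n w)%:E @[n --> \oo] --> (f w)%:E}.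
  by apply: aeW => w _; apply: cvg_EFin; [exact: nearW|exact: f_f].
have mf : measurable_fun setT (EFin \o f) by apply/measurable_EFinP; case: bf.
have mEf_ n : measurable_fun setT (EFin \o f_ n) by apply/measurable_EFinP.
have [_ _] := dominated_convergence measurableT mEf_ mf ff
  (finite_measure_integrable_cst P M measurableT) bdd.
by move=> h; apply: fine_cvg; rewrite -expectationE// unlock; exact: h.
Qed.

Variable X : normedModType R.

Lemma continuous_measurable_borel (h : X -> R) : continuous h ->
  measurable_fun [set: borel X] (h : borel X -> R).
Proof.
move=> ch; apply: (measurability _ (RGenOInfty.measurableE R)) => //.
move=> /= _ [_ [a ->] <-]; apply: measurableI => //.
apply: sub_sigma_algebra; move/continuousP : ch; apply.
exact: interval_open.
Qed.

Lemma bounded_rv_comp d (T : measurableType d) (V : T -> X) (h : X -> R) :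
  measurable_fun [set: T] (V : T -> borel X) -> continuous h ->
  (exists M, forall x, `|h x| <= M) -> bounded_rv (fun w => h (V w)).
Proof.
move=> mV ch [M hM]; split; last by exists M.
exact: (measurableT_comp (continuous_measurable_borel ch) mV).
Qed.

Lemma cvg_in_distribution_expect d (T : measurableType d) (P : probability T R)
    d' (T' : measurableType d') (P' : probability T' R)
    (V : nat -> T -> X) (V' : T' -> X) (h : X -> R) :
  (forall n, measurable_fun [set: T] (V n : T -> borel X)) ->
  measurable_fun [set: T'] (V' : T' -> borel X) ->
  cvg_in_distribution P P' V V' ->
  continuous h -> (exists M, forall x, `|h x| <= M) ->
  expect P (fun w => h (V n w)) @[n --> \oo] --> expect P' (fun w => h (V' w)).
Proof.
move=> mV mV' VV' ch hM; apply: fine_cvg.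
rewrite -expectationE; last exact: bounded_rv_comp.
by have := VV' h ch hM; rewrite unlock.
Qed.

Section PartitionOfUnity.
Variables (y : nat -> X) (e : R).
Hypothesis e0 : 0 < e.

(** Equal to 1 on the ball of radius e around y j, and to 0 outside the ball of
    radius 2 e. *)
Definition bump j x : R := Num.max 0 (Num.min 1 (2 - e^-1 * `|x - y j|)).

Lemma bump01 j x : 0 <= bump j x <= 1.
Proof. by rewrite /bump le_max lexx/= ge_max ler01 ge_min lexx. Qed.

Lemma bump_center j x : `|x - y j| <= e -> bump j x = 1.
Proof.
move=> xy; have : e^-1 * `|x - y j| <= 1 by rewrite mulrC ler_pdivrMr// mul1r.
by move=> h; rewrite /bump min_l; [rewrite max_r|lra].
Qed.

Lemma bump_support j x : bump j x != 0 -> `|x - y j| <= 2 * e.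
Proof.
apply: contraNT; rewrite -ltNge => xy; apply/eqP.
have h : 2 < e^-1 * `|x - y j| by rewrite mulrC ltr_pdivlMr.
by rewrite /bump min_r; [rewrite max_l|]; lra.
Qed.

Lemma continuous_bump j : continuous (bump j).
Proof.
move=> x; apply: (@continuous_max R X (fun=> 0) (fun x => Num.min 1 (2 - e^-1 *
  `|x - y j|))).
  exact: cvg_cst.
apply: (@continuous_min R X (fun=> 1) (fun x => 2 - e^-1 * `|x - y j|)).
  exact: cvg_cst.
apply: cvgB; first exact: cvg_cst.
apply: cvgM; first exact: cvg_cst.
by apply: cvg_norm; apply: cvgB; [exact: cvg_id|exact: cvg_cst].
Qed.

(** The part of the unit mass that the first n bumps leave uncovered.  Taking
    from bump j only what remains before it gives the [cell]s, whose partial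
    sums are 1 - leftover without any division. *)
Definition leftover n x : R := \prod_(i < n) (1 - bump i x).

Definition cell j x : R := bump j x * leftover j x.

Lemma leftover01 n x : 0 <= leftover n x <= 1.
Proof.
by apply: prod_unit_itv => i; exact/unit_itv_onem/bump01.
Qed.

Lemma cell01 j x : 0 <= cell j x <= 1.
Proof.
have /andP[b0 b1] := bump01 j x; have /andP[l0 l1] := leftover01 j x.
by rewrite /cell mulr_ge0//= mulr_ile1.
Qed.

Lemma sum_cell n x : \sum_(j < n) cell j x = 1 - leftover n x.
Proof.
rewrite /leftover; elim: n => [|n IH]; first by rewrite !big_ord0 subrr.
by rewrite !big_ord_recr /= IH /cell /leftover; ring.
Qed.

Lemma continuous_leftover n : continuous (leftover n).
Proof.
move=> x; apply: cvg_big => [|i _]; first exact: mul_continuous.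
by apply: cvgB; [exact: cvg_cst|exact: continuous_bump].
Qed.

Lemma continuous_cell j : continuous (cell j).
Proof.
by move=> x; apply: cvgM; [exact: continuous_bump|exact: continuous_leftover].
Qed.

Lemma leftover_eq0 n j x : (j < n)%N -> `|x - y j| <= e -> leftover n x = 0.
Proof.
move=> jn xy; rewrite /leftover (bigD1 (Ordinal jn))//= bump_center//.
by rewrite subrr mul0r.
Qed.

Lemma cell_support j x : cell j x != 0 -> `|x - y j| <= 2 * e.
Proof. by rewrite mulf_eq0 negb_or => /andP[/bump_support]. Qed.

Lemma cvg_leftover x : (exists j, `|x - y j| < e) ->
  leftover n x @[n --> \oo] --> 0.
Proof.
move=> [j xy]; apply: cvg_near_cst; exists j.+1 => // n /= jn.
by rewrite (@leftover_eq0 _ j)// ltW.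
Qed.

End PartitionOfUnity.
End Convergence.

Lemma cvg_exprn (R : realType) (u : nat -> R) (a : R) (k : nat) :
  u n @[n --> \oo] --> a -> u n ^+ k @[n --> \oo] --> a ^+ k.
Proof.
move=> ua; apply: (cvg_comp u (fun x => x ^+ k) ua).
exact: exprn_continuous.
Qed.

(** * Joint convergence of independent copies *)

Section JointConvergence.
Variables (R : realType) (X : normedModType R) (k : nat).

Variables (F : ('I_k -> X) -> R) (M L : R).
Hypotheses (L0 : 0 <= L) (FM : forall x, `|F x| <= M).
Hypothesis FL : forall x y, `|F x - F y| <= L * \sum_i `|x i - y i|.

Section Approximation.
Variables (y : nat -> X) (e : R) (n : nat).
Hypothesis e0 : 0 < e.

(** A sum of products of functions of one variable that stays close to F: F is
    frozen at the centres y (J i) of the cells. *)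
Definition cell_sum (x : 'I_k -> X) : R :=
  \sum_(J : {ffun 'I_k -> 'I_n})
    F (fun i => y (J i)) * \prod_i cell y e (J i) (x i).

(** Where the cells J carry mass at x, all x i are within 2 e of the centres,
    whence the first term.  On the mass outside all the cells only the bound M
    on F is available, whence the second term. *)
Lemma cell_sum_approx x :
  `|F x - cell_sum x| <=
  L * (k%:R * (2 * e)) + M * (1 - \prod_i (1 - leftover y e n (x i))).
Proof.
pose c (J : {ffun 'I_k -> 'I_n}) := \prod_i cell y e (J i) (x i).
have c0 J : 0 <= c J.
  by apply: prodr_ge0 => i _; have /andP[] := cell01 y e (J i) (x i).
have uE : \prod_i (1 - leftover y e n (x i)) = \sum_J c J.
  under eq_bigr do rewrite -sum_cell.
  by rewrite bigA_distr_bigA.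
have /andP[u0 u1] : 0 <= \sum_J c J <= 1.
  by rewrite -uE; apply: prod_unit_itv => i; exact/unit_itv_onem/leftover01.
rewrite uE (_ : F x - _ = \sum_(J : {ffun 'I_k -> 'I_n})
    (F x - F (fun i => y (J i))) * c J + F x * (1 - \sum_J c J)); last first.
  under eq_bigr do rewrite mulrBl.
  rewrite sumrB -mulr_sumr.
  rewrite -[cell_sum x]/(\sum_(J : {ffun 'I_k -> 'I_n})
    F (fun i => y (J i)) * c J).
  by ring.
rewrite (le_trans (ler_normD _ _))// lerD//; last first.
  by rewrite normrM [X in _ * X <= _]ger0_norm ?subr_ge0// ler_wpM2r// subr_ge0.
rewrite (le_trans (ler_norm_sum _ _ _))//.
apply: (@le_trans _ _ (\sum_J L * (k%:R * (2 * e)) * c J)); last first.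
  rewrite -mulr_sumr ler_piMr//.
  by rewrite mulr_ge0// mulr_ge0// mulr_ge0// ltW.
apply: ler_sum => J _; rewrite normrM (ger0_norm (c0 J)).
have [->|cJ] := eqVneq (c J) 0; first by rewrite !mulr0.
rewrite ler_wpM2r// (le_trans (FL _ _))// ler_wpM2l//.
apply: (@le_trans _ _ (\sum_(i < k) 2 * e)); last first.
  by rewrite sumr_const card_ord -[_ *+ k]mulr_natl.
apply: ler_sum => i _; apply: cell_support => //.
by move/prodf_neq0 : cJ => /(_ i); exact.
Qed.

(** After taking expectations both the approximation and the error bound depend
    on the common law of the coordinates only, through the expectations of
    finitely many continuous functions. *)
Lemma expect_cell_sum_approx d0 d1 (T0 : measurableType d0)
    (T : measurableType d1)
    (P0 : probability T0 R) (P : probability T R)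
    (V : 'I_k -> T -> X) (V0 : T0 -> X) :
  (forall i, random_element (V i)) -> random_element V0 ->
  independent_copies P0 P (V : 'I_k -> T -> borel X) V0 ->
  `|expect P (fun w => F (V ^~ w)) -
    \sum_(J : {ffun 'I_k -> 'I_n}) F (fun i => y (J i)) *
      \prod_i expect P0 (fun w => cell y e (J i) (V0 w))| <=
  L * (k%:R * (2 * e)) +
  M * (1 - (1 - expect P0 (fun w => leftover y e n (V0 w))) ^+ k).
Proof.
move=> rV rV0 indV.
have mV i : measurable_fun [set: T] (V i : T -> borel X) by case: (rV i).
have mV0 : measurable_fun [set: T0] (V0 : T0 -> borel X) by case: rV0.
have bcell j d' (T' : measurableType d') (W : T' -> X) :
    measurable_fun setT (W : T' -> borel X) ->
    bounded_rv (fun w => cell y e j (W w)).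
  move=> mW; apply: bounded_rv_comp => //; first exact: continuous_cell.
  by exists 1 => x; exact/normr_unit_itv/cell01.
have bleft j d' (T' : measurableType d') (W : T' -> X) :
    measurable_fun setT (W : T' -> borel X) ->
    bounded_rv (fun w => leftover y e j (W w)).
  move=> mW; apply: bounded_rv_comp => //; first exact: continuous_leftover.
  by exists 1 => x; exact/normr_unit_itv/leftover01.
have bF : bounded_rv (fun w => F (V ^~ w)).
  split; last by exists M.
  have mF := measurable_lipschitz_comp (Z := R^o) L0 FL rV.
  (* The identity of R converts Borel measurability for the norm topology into
     measurability for the sigma-algebra generated by intervals. *)
  have mid := @continuous_measurable_borel R R^o id (fun=> cvg_id).
  exact: (measurableT_comp mid mF).
rewrite (_ : \sum_J _ = expect P (fun w => cell_sum (V ^~ w))); last first.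
  rewrite /cell_sum expect_sum; last first.
    move=> J; apply: bounded_rvM; first exact: bounded_rv_cst.
    by apply: bounded_rv_prod => i; exact: bcell.
  apply: eq_bigr => J _; rewrite expectZ; last first.
    by apply: bounded_rv_prod => i; exact: bcell.
  congr (_ * _); apply/esym.
  apply: (expect_prod_independent mV mV0 indV (h := fun i => cell y e (J i))).
    by move=> i; apply: continuous_measurable_borel; exact: continuous_cell.
  by move=> i s; exact: cell01.
have bu : bounded_rv (fun w => \prod_i (1 - leftover y e n (V i w))).
  apply: bounded_rv_prod => i.
  by apply: bounded_rvB; [exact: bounded_rv_cst|exact: bleft].
have uE : expect P (fun w => \prod_i (1 - leftover y e n (V i w))) =
    (1 - expect P0 (fun w => leftover y e n (V0 w))) ^+ k.
  rewrite (expect_prod_independent mV mV0 indV (h := fun i x => 1 - leftover y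
    e n x)).
  - by rewrite expectB ?expect_cst ?prodr_const ?card_ord//;
    [exact: bounded_rv_cst|exact: bleft].
  - move=> i; apply: (@continuous_measurable_borel _ _ (fun x => 1 - leftover y
    e n x)) => x.
    by apply: cvgB; [exact: cvg_cst|exact: continuous_leftover].
  - by move=> i s; exact/unit_itv_onem/leftover01.
have bc : bounded_rv (fun w => cell_sum (V ^~ w)).
  apply: bounded_rv_sum => J; apply: bounded_rvM; first exact: bounded_rv_cst.
  by apply: bounded_rv_prod => i; exact: bcell.
rewrite -uE.
have bone : bounded_rv (fun _ : T => 1 : R) by exact: bounded_rv_cst.
have b1u : bounded_rv (fun w => 1 - \prod_i (1 - leftover y e n (V i w))).
  exact: bounded_rvB.
have bMu := bounded_rvM (bounded_rv_cst _ M) b1u.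
rewrite (_ : 1 - expect P _ =
    expect P (fun w => 1 - \prod_i (1 - leftover y e n (V i w)))); last first.
  by rewrite (expectB P bone bu) expect_cst.
rewrite [leRHS](_ : _ = expect P (fun w => L * (k%:R * (2 * e)) +
    M * (1 - \prod_i (1 - leftover y e n (V i w))))); last first.
  by rewrite (expectD P (bounded_rv_cst _ _) bMu) expect_cst (expectZ P M b1u).
apply: ler_expect_dist => // [|w]; last exact: cell_sum_approx.
apply: bounded_rvD; first exact: bounded_rv_cst.
by apply: bounded_rvM => //; exact: bounded_rv_cst.
Qed.

End Approximation.

(** First e is chosen so that the oscillation term is below eps / 4, then the
    number N of cells so that they cover the law of Y up to a small mass.  For
    these e and N, the approximation and the error bound at W n converge to
    those at Y.  The total error is the sum of two oscillation terms, two
      remainders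
    and the distance between the approximations. *)
Lemma independent_copies_cvg_lipschitz
    d (T : measurableType d) (P : probability T R)
    dY (TY : measurableType dY) (PY : probability TY R) (Y : TY -> X)
    dC (TC : measurableType dC) (PC : probability TC R) (Yc : 'I_k -> TC -> X)
    (V : nat -> 'I_k -> T -> X) (W : nat -> T -> X) :
  (forall n i, random_element (V n i)) -> (forall n, random_element (W n)) ->
  (forall i, random_element (Yc i)) -> random_element Y ->
  (forall n, independent_copies P P (V n : 'I_k -> T -> borel X) (W n)) ->
  independent_copies PY PC (Yc : 'I_k -> TC -> borel X) Y ->
  cvg_in_distribution P PY W Y ->
  expect P (fun w => F (V n ^~ w)) @[n --> \oo] -->
  expect PC (fun w => F (Yc ^~ w)).
Proof.
move=> rV rW rYc rY indV indY WY.
apply/cvgrPdist_lt => eps eps0.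
have [y yY] := random_element_dense rY.
(* The term 1 keeps the denominator positive when L or k is 0. *)
pose e := eps / (8 * (L * k%:R + 1)).
have den0 : 0 < 8 * (L * k%:R + 1) by rewrite mulr_gt0// ltr_pwDr// mulr_ge0.
have e0 : 0 < e by rewrite divr_gt0.
have Le : L * (k%:R * (2 * e)) < eps / 4.
  rewrite /e (_ : L * _ = (eps / 4) * ((L * k%:R) / (L * k%:R + 1))).
    rewrite gtr_pMr ?divr_gt0// ltr_pdivrMr ?mul1r ?ltrDl//.
    by rewrite ltr_pwDr// mulr_ge0.
  by field; rewrite gt_eqF// ltr_pwDr// mulr_ge0.
pose l n := expect PY (fun w => leftover y e n (Y w)).
have left1 n x : `|leftover y e n x| <= 1.
  exact/normr_unit_itv/leftover01.
have mW n : measurable_fun [set: T] (W n : T -> borel X) by case: (rW n).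
have mY : measurable_fun [set: TY] (Y : TY -> borel X) by case: rY.
have l0 : l n @[n --> \oo] --> 0.
  rewrite -(expect_cst PY 0);
    apply: (@expect_bounded_cvg _ _ _ PY _ (fun=> 0) 1) => //.
  - move=> n; apply: (@bounded_rv_comp _ _ _ _ Y (leftover y e n) _ _ _).1 =>
    //.
      exact: continuous_leftover.
    by exists 1.
  - exact: bounded_rv_cst.
  - by move=> w; apply: cvg_leftover => //; exact: yY.
have : M * (1 - (1 - l n) ^+ k) @[n --> \oo] --> M * (1 - (1 - 0) ^+ k).
  apply: cvgM; first exact: cvg_cst.
  apply: cvgB; first exact: cvg_cst.
  apply: cvg_exprn.
  by apply: cvgB; [exact: cvg_cst|].
rewrite subr0 expr1n subrr mulr0 => /cvgrPdist_lt/(_ (eps / 8)).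
rewrite divr_gt0// => /(_ isT)[N _ /(_ N (leqnn N))];
  rewrite /= sub0r normrN => hN.
pose s n := \sum_(J : {ffun 'I_k -> 'I_N}) F (fun i => y (J i)) *
      \prod_i expect P (fun w => cell y e (J i) (W n w)).
pose sY := \sum_(J : {ffun 'I_k -> 'I_N}) F (fun i => y (J i)) *
      \prod_i expect PY (fun w => cell y e (J i) (Y w)).
have cs : s n @[n --> \oo] --> sY.
  apply: cvg_big => [|J _]; first exact: add_continuous.
  apply: cvgM; first exact: cvg_cst.
  apply: cvg_big => [|i _]; first exact: mul_continuous.
  apply: cvg_in_distribution_expect => //; first exact: continuous_cell.
  by exists 1 => x; exact/normr_unit_itv/cell01.
pose u n := M * (1 - (1 - expect P (fun w => leftover y e N (W n w))) ^+ k).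
have cu : u n @[n --> \oo] --> M * (1 - (1 - l N) ^+ k).
  apply: cvgM; first exact: cvg_cst.
  apply: cvgB; first exact: cvg_cst.
  apply: cvg_exprn.
  apply: cvgB; first exact: cvg_cst.
  apply: cvg_in_distribution_expect => //; first exact: continuous_leftover.
  by exists 1.
near=> n.
have h1 := expect_cell_sum_approx y N e0 (rV n) (rW n) (indV n).
have h2 := expect_cell_sum_approx y N e0 rYc rY indY.
have h3 : `|sY - s n| < eps / 8.
  by near: n; move/cvgrPdist_lt : cs; apply; rewrite divr_gt0.
have h4 : `|M * (1 - (1 - l N) ^+ k) - u n| < eps / 8.
  by near: n; move/cvgrPdist_lt : cu; apply; rewrite divr_gt0.
rewrite -/(s n) -/(u n) in h1; rewrite -/sY -/(l N) in h2.
clearbody u s sY; move: h1 h2 h3 h4 hN Le.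
rewrite !ler_norml !ltr_norml => /andP[? ?] /andP[? ?] /andP[? ?] /andP[? ?]
  /andP[? ?] ?.
by apply/andP; split; lra.
Unshelve. all: by end_near. Qed.

End JointConvergence.

(** * From Lipschitz to continuous test functions *)

Section LipschitzEnvelope.
Variables (R : realType) (X : normedModType R) (f : X -> R) (M : R).
Hypotheses (cf : continuous f) (fM : forall x, `|f x| <= M).

(** The largest L-Lipschitz function below f (the Pasch-Hausdorff envelope). *)
Definition lipschitz_envelope (L : R) (x : X) : R :=
  inf (range (fun y => f y + L * `|x - y|)).

Let lower (L : R) x y : 0 <= L -> - M <= f y + L * `|x - y|.
Proof.
move=> L0; have := fM y; rewrite ler_norml => /andP[My _].
by rewrite (le_trans My)// lerDl mulr_ge0.
Qed.

Lemma lipschitz_envelope_le L x y : 0 <= L ->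
  lipschitz_envelope L x <= f y + L * `|x - y|.
Proof.
move=> L0; apply: ge_inf; last by exists y.
by exists (- M) => _ [z _ <-]; exact: lower.
Qed.

Lemma lipschitz_envelope_ge L x (c : R) :
  (forall y, c <= f y + L * `|x - y|) -> c <= lipschitz_envelope L x.
Proof.
by move=> h; apply: lb_le_inf;
  [exists (f x + L * `|x - x|), x|move=> _ [y _ <-]].
Qed.

Lemma lipschitz_envelope_le_fun L x : 0 <= L -> lipschitz_envelope L x <= f x.
Proof.
by move=> L0; have := lipschitz_envelope_le x x L0;
  rewrite subrr normr0 mulr0 addr0.
Qed.

Lemma lipschitz_envelope_bounded L x : 0 <= L -> `|lipschitz_envelope L x| <= M.
Proof.
move=> L0; have := fM x; rewrite !ler_norml => /andP[_ fxM].
rewrite (le_trans (lipschitz_envelope_le_fun x L0) fxM) andbT.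
by apply: lipschitz_envelope_ge => y; exact: lower.
Qed.

Lemma lipschitz_envelope_lipschitz L x x' : 0 <= L ->
  `|lipschitz_envelope L x - lipschitz_envelope L x'| <= L * `|x - x'|.
Proof.
move=> L0.
have H u v : lipschitz_envelope L u - L * `|u - v| <= lipschitz_envelope L v.
  apply: lipschitz_envelope_ge => y; rewrite lerBlDr.
  rewrite (le_trans (lipschitz_envelope_le u y L0))// -addrA lerD2l -mulrDr.
  by rewrite ler_wpM2l// [leRHS]addrC ler_distD.
rewrite ler_norml; have := H x x'; have := H x' x; rewrite (distrC x' x).
by move=> ? ?; apply/andP; split; lra.
Qed.

(** Points y near x give values close to f x or above by continuity; at distance
    r or more, the penalty n r exceeds the oscillation 2 M as soon as n is
    large. *)
Lemma cvg_lipschitz_envelope x :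
  lipschitz_envelope n%:R x @[n --> \oo] --> f x.
Proof.
apply/cvgrPdist_le => e e0.
have [r /= r0 hr] : exists2 r : R, 0 < r &
    forall y, `|x - y| < r -> `|f x - f y| < e.
  have /cvgrPdist_lt/(_ e e0)/nbhs_ballP[r /= r0 hr] : f y @[y --> x] --> f x
    by exact: cf.
  by exists r => // y xy; apply: hr; rewrite -ball_normE.
near=> n.
have n0 : 0 <= n%:R :> R by [].
rewrite ger0_norm ?subr_ge0 ?lipschitz_envelope_le_fun// lerBlDl -lerBlDr.
apply: lipschitz_envelope_ge => y.
have [xy|xy] := ltP `|x - y| r.
  have := hr y xy; rewrite ltr_norml => /andP[_ h].
  have : 0 <= n%:R * `|x - y| by rewrite mulr_ge0.
  by lra.
have h1 : n%:R * r <= n%:R * `|x - y| by rewrite ler_wpM2l.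
have h2 : 2 * M <= n%:R * r.
  by rewrite -ler_pdivrMr//; near: n; exact: nbhs_infty_ger.
have := fM x; have := fM y; rewrite !ler_norml => /andP[? ?] /andP[? ?].
by lra.
Unshelve. all: by end_near. Qed.

End LipschitzEnvelope.

Section Portmanteau.
Variables (R : realType) (X : normedModType R).
Variables (d : measure_display) (T : measurableType d) (P : probability T R).
Variables (d' : measure_display) (T' : measurableType d').
Variable P' : probability T' R.
Variables (V : nat -> T -> X) (V' : T' -> X).
Hypothesis mV : forall n, measurable_fun [set: T] (V n : T -> borel X).
Hypothesis mV' : measurable_fun [set: T'] (V' : T' -> borel X).
Hypothesis lipV : forall (f : X -> R) (L M : R), 0 <= L ->
  (forall x, `|f x| <= M) -> (forall x y, `|f x - f y| <= L * `|x - y|) ->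
  expect P (fun w => f (V n w)) @[n --> \oo] --> expect P' (fun w => f (V' w)).

Lemma lipschitz_continuous (f : X -> R) (L : R) : 0 <= L ->
  (forall x y, `|f x - f y| <= L * `|x - y|) -> continuous f.
Proof.
move=> L0 fL x; apply/cvgrPdist_lt => e e0.
have L1 : 0 < L + 1 by rewrite ltr_pwDr.
apply/nbhs_ballP; exists (e / (L + 1)) => /=; first by rewrite divr_gt0.
move=> y; rewrite -ball_normE /= => xy; rewrite (le_lt_trans (fL _ _))//.
rewrite ltr_pdivlMr// in xy; apply: le_lt_trans xy.
by rewrite mulrC ler_wpM2l// lerDl.
Qed.

(** A Lipschitz envelope of f has an expectation at V' close to that of f, by
    dominated convergence;
      its expectations at V n converge, and they bound those
    of f from below. *)
Lemma expect_lower_semicontinuous (f : X -> R) (M e : R) :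
  continuous f -> (forall x, `|f x| <= M) -> 0 < e ->
  \forall n \near \oo,
    expect P' (fun w => f (V' w)) - e < expect P (fun w => f (V n w)).
Proof.
move=> cf fM e0.
have bV (h : X -> R) n : continuous h -> (forall x, `|h x| <= M) ->
    bounded_rv (fun w => h (V n w)).
  by move=> ch hM; apply: bounded_rv_comp => //; exists M.
have bV' (h : X -> R) : continuous h -> (forall x, `|h x| <= M) ->
    bounded_rv (fun w => h (V' w)).
  by move=> ch hM; apply: bounded_rv_comp => //; exists M.
have cE (L : nat) : continuous (lipschitz_envelope f L%:R).
  apply: (@lipschitz_continuous _ L%:R) => // x y.
  exact: (lipschitz_envelope_lipschitz fM).
have EM (L : nat) x : `|lipschitz_envelope f L%:R x| <= M.
  exact: lipschitz_envelope_bounded.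
have : expect P' (fun w => lipschitz_envelope f L%:R (V' w)) @[L --> \oo] -->
    expect P' (fun w => f (V' w)).
  apply: (expect_bounded_cvg (M := M)) => //.
  - by move=> L; have [] := bV' _ (cE L) (EM L).
  - exact: bV'.
  - by move=> w; exact: (cvg_lipschitz_envelope cf fM).
move=> /cvgrPdist_lt/(_ (e / 2));
  rewrite divr_gt0// => /(_ isT)[L _ /(_ L (leqnn L))].
rewrite /= ltr_norml => /andP[_ hL].
have := lipV (ler0n R L) (EM L) (fun x y => lipschitz_envelope_lipschitz fM x y
  (ler0n R L)).
move=> /cvgrPdist_lt/(_ (e / 2)); rewrite divr_gt0// => /(_ isT);
  apply: filterS => n.
rewrite ltr_norml => /andP[_ hn].
have : expect P (fun w => lipschitz_envelope f L%:R (V n w)) <=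
    expect P (fun w => f (V n w)).
  apply: le_expect; [exact: bV|exact: bV|].
  by move=> w; exact: (lipschitz_envelope_le_fun fM).
by lra.
Qed.

(** The lower bounds for f and for - f together give the limit. *)
Lemma cvg_in_distribution_lipschitz : cvg_in_distribution P P' V V'.
Proof.
move=> f cf [M fM].
have bf n : bounded_rv (fun w => f (V n w)) by apply: bounded_rv_comp => //;
  exists M.
have bf' : bounded_rv (fun w => f (V' w)) by apply: bounded_rv_comp => //;
  exists M.
rewrite (expectationE P' bf').
rewrite (_ : (fun n => _) = fun n => (expect P (fun w => f (V n w)))%:E);
  last first.
  by apply/funext => n; rewrite -(expectationE P (bf n)).
apply: cvg_EFin; first exact: nearW.
apply/cvgrPdist_lt => e e0.
have cNf : continuous (fun x => - f x) by move=> x; apply: cvgN; exact: cf.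
have NfM x : `|- f x| <= M by rewrite normrN.
have expectN dd (TT : measurableType dd) (PP : probability TT R) (g : TT -> R) :
    bounded_rv g -> expect PP (fun w => - g w) = - expect PP g.
  move=> bg; rewrite -mulN1r -expectZ//; congr (expect PP _).
  by apply/funext => w; rewrite mulN1r.
near=> n.
have h1 : expect P' (fun w => f (V' w)) - e < expect P (fun w => f (V n w)).
  by near: n; exact: (expect_lower_semicontinuous cf fM).
have h2 : expect P' (fun w => - f (V' w)) - e < expect P (fun w => - f (V n w)).
  by near: n; exact: (expect_lower_semicontinuous cNf NfM).
move: h1 h2; rewrite !expectN// ltr_norml => h1 h2.
by apply/andP; split=> /=; lra.
Unshelve. all: by end_near. Qed.

End Portmanteau.

(** * Transfer of random elements and of independent copies *)

Section Transfer.
Variables (R : realType) (X : normedModType R).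

Lemma random_element_comp d d' (T : measurableType d) (S : measurableType d')
    (g : S -> X) (f : T -> S) :
  random_element g -> measurable_fun [set: T] f -> random_element (g \o f).
Proof.
move=> [mg [D cD gD]] mf; split; first exact: (measurableT_comp mg mf).
by exists D => // _ [w _ <-]; apply: gD; exists (f w).
Qed.

Lemma continuous_borel (c : X -> X) : continuous c ->
  measurable_fun [set: borel X] (c : borel X -> borel X).
Proof.
move=> cc; apply: (@measurability _ _ _ (borel X) _ _ (@open X)) => // _ [B oB
  <-].
apply: measurableI => //; apply: sub_sigma_algebra.
by move/continuousP : cc; apply.
Qed.

Lemma random_element_continuous d (T : measurableType d) (f : T -> X)
    (c : X -> X) : continuous c -> random_element f -> random_element (c \o f).
Proof.
move=> cc [mf [D cD fD]]; split; last first.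
  exists (c @` D); first exact: (card_le_trans (card_image_le _ _)).
  move=> _ [w _ <-] B /= /cc fB.
  have : range f (f w) by exists w.
  by move=> /fD/(_ _ fB)[x [Dx Bx]]; exists (c x); split=> //; exists x.
exact: (measurableT_comp (continuous_borel cc) mf).
Qed.

End Transfer.

Section IndependentCopiesTheory.
Variables (R : realType) (d0 d1 ds : measure_display).
Variables (T0 : measurableType d0) (T : measurableType d1).
Variable S : measurableType ds.
Variables (P0 : probability T0 R) (P : probability T R) (k : nat).
Variables (V : 'I_k -> T -> S) (V0 : T0 -> S).

Lemma independent_copies_comp d' (S' : measurableType d') (g : S -> S') :
  measurable_fun [set: S] g -> independent_copies P0 P V V0 ->
  independent_copies P0 P (fun i => g \o V i) (g \o V0).
Proof.
move=> mg indV C mC; apply: (indV (fun i => g @^-1` C i)) => i.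
by rewrite -[X in measurable X]setTI; exact: mg.
Qed.

Lemma independent_copies_marginal (i : 'I_k) (A : set S) :
  independent_copies P0 P V V0 -> measurable A ->
  P (V i @^-1` A) = P0 (V0 @^-1` A).
Proof.
move=> indV mA; have := indV (fun j => if j == i then A else setT).
rewrite (bigD1 i)//= eqxx big1 ?mule1; last first.
  by move=> j /negbTE ->; rewrite preimage_setT probability_setT.
move=> <- //; last by move=> j; case: ifP.
congr (P _); apply/seteqP; split=> [w Aw j _|w /(_ i Logic.I)].
  by case: eqP => [->|].
by rewrite /= eqxx.
Qed.

Lemma iid_independent_copies : iid P V -> (forall i, same_law P P0 (V i) V0) ->
  independent_copies P0 P V V0.
Proof.
move=> [_ indV _] VV0 C mC.
rewrite (@mutually_independent_inj _ _ _ _ _ _ _ V _ id)//.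
by apply: eq_bigr => i _; exact: VV0.
Qed.

End IndependentCopiesTheory.

Lemma probability_le_sum (R : realType) d (T : measurableType d)
    (P : probability T R) (K : finType) (B : set T) (A : K -> set T) :
  measurable B -> (forall i, measurable (A i)) -> B `<=` \bigcup_i A i ->
  (P B <= \sum_i P (A i))%E.
Proof.
move=> mB mA BA.
have -> : (\sum_i P (A i) = \sum_(i \in [set: K]) P (A i))%E.
  rewrite (fsbigE (index_enum K)) ?index_enum_uniq// => [|i _].
    by apply: eq_bigl => i; rewrite in_setT.
  by rewrite mem_index_enum.
by apply: content_sub_fsum => //; exact: finite_finset.
Qed.

Lemma cvg_divn (k : nat) : (0 < k)%N -> (n %/ k)%N @[n --> \oo] --> \oo.
Proof.
move=> k0 A [N _ NA]; exists (N * k)%N => // n /= Nn; apply: NA => /=.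
by rewrite leq_divRL.
Qed.

(** * Consistency and limit law of the quantile of the block estimators *)

Unset Implicit Arguments.

Theorem theorem3p5 (R : realType) (X : normedModType R) (I : choiceType)
    (b : I -> X) (hb : hamel_basis b)
    (hnorm : forall x : X, `|x| = hamel_norm b x)
    (theta0 : X) (k : nat) (hk : (0 < k)%N)
    (alpha : I -> R) (halpha : forall l, 0 < alpha l < 1)
    (dE : measure_display) (E : measurableType dE)
    (dT : measure_display) (T : measurableType dT) (P : probability T R)
    (xi : nat -> T -> E) (hxi : iid P xi)
    (z : forall m : nat, m.-tuple E -> X)
    (hz : forall m : nat, random_element (z m))
    (blk : forall n : nat, 'I_k * 'I_(n %/ k) -> 'I_n)
    (hblk : forall n : nat, injective (blk n)) :
  (cvg_in_probability P (estimator z xi) theta0 ->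
   cvg_in_probability P (hamel_estimator b alpha z xi blk) theta0)
  /\
  (forall (dY : measure_display) (TY : measurableType dY)
      (PY : probability TY R) (Y : TY -> X) (a : nat -> R),
    random_element Y ->
    (forall n : nat, 0 <= a n) ->
    a n @[n --> \oo] --> +oo ->
    cvg_in_distribution P PY
      (fun n w => a n *: (estimator z xi n w - theta0)) Y ->
    forall (dC : measure_display) (TC : measurableType dC)
      (PC : probability TC R) (Yc : 'I_k -> TC -> X),
    iid_copies PC PY Y Yc ->
    cvg_in_distribution P PC
      (fun n w => a (n %/ k)%N *:
         (hamel_estimator b alpha z xi blk n w - theta0))
      (fun w => hamel_quantile b alpha (fun i => Yc i w))).
Proof.
pose q := @hamel_quantile R X I b alpha k.
have qL x y : `|q x - q y| <= 1 * \sum_i `|x i - y i|.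
  rewrite mul1r hnorm; under eq_bigr do rewrite hnorm.
  exact: hamel_quantile_lipschitz.
pose Z m := estimator z xi m.
pose B n i := block_estimator z xi (blk n) i.
have [mxi _ _] := hxi.
have rZ m : random_element (Z m).
  apply: (random_element_comp (hz m)); apply/measurable_fun_tnthP => j.
  by rewrite (_ : _ \o _ = xi j)//; apply/funext => w /=; rewrite tnth_mktuple.
have rB n i : random_element (B n i).
  apply: (random_element_comp (hz (n %/ k)%N)); apply/measurable_fun_tnthP => j.
  rewrite (_ : _ \o _ = xi (blk n (i, j)))//.
  by apply/funext => w /=; rewrite tnth_mktuple.
have indB n :
    independent_copies P P (B n : 'I_k -> T -> borel X) (Z (n %/ k)%N).
  exact: (independent_copies_comp (hz (n %/ k)%N).1 (iid_blocks hxi (hblk n))).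
split=> [Zcvg eps eps0|dY TY PY Y a rY a0 aoo Zcvg dC TC PC Yc [rYc iidY lawY]].
  have far_open c : @measurable _ (borel X) [set x : X | c < `|x - theta0|].
    apply: sub_sigma_algebra; rewrite (_ : [set x | _] =
      (fun x => `|x - theta0|) @^-1` `]c, +oo[%classic); last first.
      by apply/seteqP; split=> x /=; rewrite in_itv/= andbT.
    apply: open_comp => [x _|]; last exact: interval_open.
    by apply: cvg_norm; apply: cvgB; [exact: cvg_id|exact: cvg_cst].
  have mfar (V : T -> X) c : measurable_fun setT (V : T -> borel X) ->
      measurable [set w | c < `|V w - theta0|].
    by move=> mV; rewrite -[X in measurable X]setTI;
      apply: (mV measurableT _ (far_open c)).
  have k0 : 0 < k%:R :> R by rewrite ltr0n.
  pose p n := P [set w | eps / k%:R < `|Z (n %/ k)%N w - theta0|].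
  (* If every block estimator were within eps / k of theta0, the Lipschitz bound
     would put their quantile within eps of theta0. *)
  have Tp n : (P [set w | (eps <
      `|hamel_estimator b alpha z xi blk n w - theta0|)%R] <=
      \sum_(i < k) p n)%E.
    apply: (@le_trans _ _ (\sum_(i < k)
      P [set w | (eps / k%:R < `|B n i w - theta0|)%R])%E).
      apply: probability_le_sum.
      - by apply: mfar; exact: (measurable_lipschitz_comp ler01 qL (rB n)).
      - by move=> i; apply: mfar; case: (rB n i).
      - move=> w /=.
        rewrite -[hamel_estimator _ _ _ _ _ _ _]/(q (B n ^~ w)) => far.
        apply: contrapT => near.
        have close i : `|B n i w - theta0| <= eps / k%:R.
          by rewrite leNgt; apply/negP => h; apply: near; exists i.
        have : `|q (B n ^~ w) - q (fun=> theta0)| <= \sum_(i < k) eps / k%:R.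
          rewrite (le_trans (qL _ _))// mul1r.
          by apply: ler_sum => i _; exact: close.
        rewrite /q hamel_quantile_cst// sumr_const card_ord.
        rewrite -[_ *+ k]mulr_natr mulfVK ?gt_eqF//.
        by move=> /(lt_le_trans far); rewrite ltxx.
    apply: lee_sum => i _; rewrite le_eqVlt; apply/orP; left; apply/eqP.
    exact: (independent_copies_marginal i (indB n) (far_open (eps / k%:R))).
  have p0 : p n @[n --> \oo] --> 0%E.
    apply: (cvg_comp _ _ (cvg_divn hk) (Zcvg (eps / k%:R) _)).
    by rewrite divr_gt0.
  apply: (squeeze_cvge (f := fun=> 0%E) (h := fun n => (\sum_(i < k) p n)%E)).
  - by apply: nearW => n; rewrite measure_ge0 Tp.
  - exact: cvg_cst.
  - rewrite [X in _ --> X](_ : _ = \sum_(i < k) 0%E)%E; last by rewrite big1.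
    by apply: cvg_nnesum => // i _; apply: nearW => n; exact: measure_ge0.
pose c m (x : X) : X := a m *: (x - theta0).
have cc m : continuous (c m).
  by move=> x; apply: cvgZr; apply: cvgB; [exact: cvg_id|exact: cvg_cst].
pose V n i := c (n %/ k)%N \o B n i.
pose W n := c (n %/ k)%N \o Z (n %/ k)%N.
have rV n i : random_element (V n i) by exact: random_element_continuous.
have rW n : random_element (W n) by exact: random_element_continuous.
have mc m : measurable_fun [set: borel X] (c m : borel X -> borel X).
  exact: continuous_borel.
have indV n : independent_copies P P (V n : 'I_k -> T -> borel X) (W n).
  exact: (independent_copies_comp (mc _) (indB n)).
have indY : independent_copies PY PC (Yc : 'I_k -> TC -> borel X) Y.
  exact: iid_independent_copies.
have WY : cvg_in_distribution P PY W Y.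
  by move=> f cf fM; exact: (cvg_comp _ _ (cvg_divn hk) (Zcvg f cf fM)).
(* The rescaled error is the quantile of the rescaled block errors. *)
rewrite (_ : (fun n w => _) = fun n w => q (V n ^~ w)); last first.
  by apply/funext => n; apply/funext => w; rewrite -hamel_quantile_affine.
apply: cvg_in_distribution_lipschitz.
- by move=> n; exact: (measurable_lipschitz_comp ler01 qL (rV n)).
- exact: (measurable_lipschitz_comp ler01 qL rYc).
- move=> f L M L0 fM fL.
  apply: (independent_copies_cvg_lipschitz (F := f \o q) (M := M) L0 _ _ rV rW
    rYc rY indV indY WY).
    by move=> x; exact: fM.
  by move=> x y /=; rewrite (le_trans (fL _ _))// ler_wpM2l// -[leRHS]mul1r.
Qed.
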